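(* Let $n > 1$ be an integer or $n=\infty$, and let $R$ be any (associative unital) ring. The class of $\mathrm{FP}_n$-injective $R$-modules is both covering and preenveloping.
   Context: $R$-module means left $R$-module. For an integer $n\ge 0$, a module $M$ is finitely $n$-presented if there is an exact sequence $F_n\to F_{n-1}\to\cdots\to F_1\to F_0\to M\to 0$ with every $F_i$ finitely generated projective; $\mathrm{FP}_n$ is the class of finitely $n$-presented modules, and $\mathrm{FP}_\infty$ is the class of modules lying in $\mathrm{FP}_n$ for all $n\ge 0$. A left $R$-module $M$ is $\mathrm{FP}_n$-injective if $\mathrm{Ext}^1_R(F,M)=0$ for all left $R$-modules $F\in\mathrm{FP}_n$. For a class $\mathcal X$ of modules, an $\mathcal X$-precover of $M$ is a map $\varphi\colon X\to M$ with $X\in\mathcal X$ such that every map $X'\to M$ with $X'\in\mathcal X$ factors through $\varphi$; it is a cover if moreover every endomorphism $f$ of $X$ with $\varphi f=\varphi$ is an automorphism. Preenvelopes and envelopes are defined dually. $\mathcal X$ is (pre)covering, respectively (pre)enveloping, if every module has an $\mathcal X$-(pre)cover, respectively an $\mathcal X$-(pre)envelope. *)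

(* Defs.v *)
From mathcomp Require Import all_boot all_algebra.

Set Implicit Arguments.
Unset Strict Implicit.
Unset Printing Implicit Defensive.

Import GRing.Theory.
Local Open Scope ring_scope.

Section Modules.

Variable R : pzRingType.

Definition surjection (A B : lmodType R) (f : {linear A -> B}) : Prop :=
  forall y, exists x, f x = y.

Definition exact_pair (A B C : lmodType R)
    (f : {linear A -> B}) (g : {linear B -> C}) : Prop :=
  forall y, g y = 0 <-> exists x, f x = y.

Definition finitely_generated (M : lmodType R) : Prop :=
  exists (k : nat) (e : 'I_k -> M),
    forall x, exists c : 'I_k -> R, x = \sum_(i < k) c i *: e i.

Definition projective (P : lmodType R) : Prop :=
  forall (A B : lmodType R) (g : {linear A -> B}) (f : {linear P -> B}),
    surjection g -> exists h : {linear P -> A}, g \o h =1 f.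

(* The sequence is stored as a family indexed by all of nat; only its terms   *)
(* of index at most n are constrained, the others are irrelevant.             *)
Definition finitely_n_presented (n : nat) (M : lmodType R) : Prop :=
  exists (F : nat -> lmodType R) (d : forall i, {linear F i.+1 -> F i})
         (eps : {linear F 0 -> M}),
    [/\ forall i, (i <= n)%N -> finitely_generated (F i) /\ projective (F i),
        surjection eps,
        (0 < n)%N -> exact_pair (d 0) eps
      & forall i, (i.+1 < n)%N -> exact_pair (d i.+1) (d i)].

(* None stands for n = oo.                                                    *)
Definition FP (n : option nat) (M : lmodType R) : Prop :=
  if n is Some m then finitely_n_presented m M
  else forall m, finitely_n_presented m M.

Record projective_resolution (M : lmodType R) := ProjectiveResolution {
  res_obj : nat -> lmodType R;
  res_d : forall i, {linear res_obj i.+1 -> res_obj i};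
  res_aug : {linear res_obj 0 -> M};
  res_projective : forall i, projective (res_obj i);
  res_aug_surj : surjection res_aug;
  res_exact0 : exact_pair (res_d 0) res_aug;
  res_exactS : forall i, exact_pair (res_d i.+1) (res_d i)
}.

(* Ext^1_R(F, M) is the first cohomology group of the complex                 *)
(*   Hom(P_0, M) -> Hom(P_1, M) -> Hom(P_2, M) -> ...                         *)
(* for a projective resolution P of F; up to isomorphism it does not depend   *)
(* on P. It is zero when every 1-cocycle is a 1-coboundary.                   *)
Definition cocycle1 (F M : lmodType R) (P : projective_resolution F)
    (f : {linear res_obj P 1 -> M}) : Prop :=
  forall x, f (res_d P 1 x) = 0.

Definition coboundary1 (F M : lmodType R) (P : projective_resolution F)
    (f : {linear res_obj P 1 -> M}) : Prop :=
  exists g : {linear res_obj P 0 -> M}, g \o res_d P 0 =1 f.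

Definition Ext1_zero (F M : lmodType R) : Prop :=
  forall (P : projective_resolution F) (f : {linear res_obj P 1 -> M}),
    cocycle1 f -> coboundary1 f.

Definition FP_injective (n : option nat) (M : lmodType R) : Prop :=
  forall F : lmodType R, FP n F -> Ext1_zero F M.

Section Approximations.

Variable X : lmodType R -> Prop.

Definition is_precover (M C : lmodType R) (phi : {linear C -> M}) : Prop :=
  X C /\ forall (C' : lmodType R) (f : {linear C' -> M}), X C' ->
    exists g : {linear C' -> C}, phi \o g =1 f.

Definition is_cover (M C : lmodType R) (phi : {linear C -> M}) : Prop :=
  is_precover phi /\
  forall f : {linear C -> C}, phi \o f =1 phi -> bijective f.

Definition is_preenvelope (M E : lmodType R) (phi : {linear M -> E}) : Prop :=
  X E /\ forall (E' : lmodType R) (f : {linear M -> E'}), X E' ->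
    exists g : {linear E -> E'}, g \o phi =1 f.

Definition covering : Prop :=
  forall M : lmodType R, exists (C : lmodType R) (phi : {linear C -> M}),
    is_cover phi.

Definition preenveloping : Prop :=
  forall M : lmodType R, exists (E : lmodType R) (phi : {linear M -> E}),
    is_preenvelope phi.

End Approximations.

End Modules.

(* Main.v *)
From HB Require Import structures.
Require Import Defs.
From mathcomp Require Import all_boot all_algebra.
From mathcomp Require Import boolp classical_sets functions.

Set Implicit Arguments.
Unset Strict Implicit.
Unset Printing Implicit Defensive.

Import GRing.Theory.
Local Open Scope ring_scope.

(** Let X be the class of FP_n-injective modules.  The first point is that X is
    cut out by finite linear systems.  Since n > 1, a module F in FP_n has a
    presentation R^m -B-> R^k -C-> R^l -> F -> 0 by finite free modules, so a
    homomorphism from the first syzygy of F to M is a solution x in M^k of the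
    finite system B x = 0, and Ext^1(F, M) = 0 says that each such x has the
    form C y ([FP_injective_testable]).  Having finitely many equations is what
    fails for n = 1.  From then on X is the class [testable] of the modules that
    pass all tests (B, C) of a given set, where B C = 0; such a class is closed
    under products, extensions and directed colimits.  Moreover every element
    of a testable module lies in a submodule of bounded size, closed under
    solving finite linear systems, such that this submodule and the quotient by
    it are both testable ([purify]).

    Preenvelopes.  By [purify], every map from M to a testable module factors
    through a testable quotient of one free module that depends on M only.  The
    product of all such quotients, over all maps from M to them, is a
    preenvelope of M ([testable_preenveloping]).

    Precovers.  A module C over M is built by gluing free modules R^(T) along
    submodules K with R^(T)/K testable, until every map K -> C whose composite
    with C -> M extends to R^(T) extends compatibly to R^(T) -> C
    ([small_object]).  Each gluing is an extension by R^(T)/K, hence C is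
    testable.  Given a map from a testable module X to M, a maximal partial lift
    to C among those whose domain has a testable quotient is defined everywhere,
    since [purify] provides a small step beyond any proper domain
    ([testable_precover]).

    Covers.  This is the argument of Enochs for classes closed under directed
    colimits.  Let C be a precover of M.  A maximal chain of copies of C yields
    an endomorphism b over M such that no f over M gives f b a larger kernel
    than b ([stable_endo]); the colimit of C -b-> C -b-> ... is then a precover
    all of whose endomorphisms over M are injective ([injective_precover]).  If
    one of them were not surjective, it would produce chains of copies of the
    colimit of any length, each properly contained in the next, and these embed
    in the module; a chain indexed by its power set contradicts the theorem of
    Cantor ([injective_endo_surjective]).

    Zorn's lemma takes the place of transfinite recursion throughout: the objects
    are encoded as relations of a kind that is closed under unions of chains. *)

(** * Zorn's lemma and finite families in directed sets *)

(** Unions of nonempty families suffice because a starting point [A0] is given: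
    the structures to which this is applied are never empty as sets. *)
Lemma zorn_sets (T : Type) (P : (T -> Prop) -> Prop) (A0 : T -> Prop) :
  P A0 ->
  (forall F : (T -> Prop) -> Prop, (exists A, F A) -> (forall A, F A -> P A) ->
     (forall A B, F A -> F B ->
        exists C, [/\ F C, (A `<=` C)%classic & (B `<=` C)%classic]) ->
     P (fun x => exists2 A, F A & A x)) ->
  exists2 A, P A & forall B, P B -> (A `<=` B)%classic -> (B `<=` A)%classic.
Proof.
move=> PA0 PU.
have [|A [PA Amax]] := @Zorn_bigcup T (fun A => A = set0 \/ P A)%classic.
  move=> F FP Ftot.
  have [[A [FA PA]]|nF] := pselect (exists A, F A /\ P A); last first.
    left; rewrite -subset0 => x [A FA Ax]; have [A0'|PA] := FP A FA.
      by rewrite A0' in Ax.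
    by case: nF; exists A.
  right; rewrite (_ : (\bigcup_(X in F) X)%classic =
                   fun x => exists2 A, F A /\ P A & A x).
    apply: PU; first by exists A.
      by move=> B [].
    move=> B C [FB PB] [FC PC]; case: (Ftot B C FB FC) => BC.
        by exists C; split.
      by exists B; split.
  apply/funext => x; apply/propext; split=> [[B FB Bx]|[B [FB _] Bx]].
    by have [B0|PB] := FP B FB; [rewrite B0 in Bx | exists B].
  by exists B.
have max B : P B -> (A `<=` B)%classic -> (B `<=` A)%classic.
  move=> PB AB; apply: contrapT => nBA.
  by apply: (Amax B); [split | right].
case: PA => [A_0|PA]; last by exists A.
have A0A := max A0 PA0; rewrite A_0 in A0A max.
have A00 : A0 = set0 by apply/seteqP; split; [exact: A0A|].
by exists set0 => //; rewrite -A00.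
Qed.

Lemma directed_fin (I : Type) (J : I -> Prop) (r : I -> I -> Prop) :
  (exists i, J i) -> (forall i j k, r i j -> r j k -> r i k) ->
  (forall i j, J i -> J j -> exists k, [/\ J k, r i k & r j k]) ->
  forall n (f : 'I_n -> I), (forall i, J (f i)) ->
  exists2 k, J k & forall i, r (f i) k.
Proof.
move=> [i0 Ji0] rT dir; elim=> [|n IH] f Jf.
  by exists i0 => // -[].
have [k Jk fk] := IH (fun i => f (lift ord0 i)) (fun i => Jf _).
have [l [Jl kl fl]] := dir _ _ Jk (Jf ord0).
exists l => // i; case: (unliftP ord0 i) => [j ->|-> //].
exact: rT (fk j) kl.
Qed.

Section Modules.
Variable R : pzRingType.
Implicit Types A X Y : lmodType R.

(** * Submodules, linear relations, subquotients *)

Definition submod A (S : A -> Prop) :=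
  S 0 /\ forall (a : R) u v, S u -> S v -> S (a *: u + v).

Section Submod.
Variables (A : lmodType R) (S : A -> Prop) (hS : submod S).

Lemma submod0 : S 0. Proof. by case: hS. Qed.

Lemma submodD u v : S u -> S v -> S (u + v).
Proof. by move=> Su Sv; rewrite -[u]scale1r; apply: hS.2. Qed.

Lemma submodZ a u : S u -> S (a *: u).
Proof. by move=> Su; rewrite -[_ *: _]addr0; apply: hS.2; last exact: submod0. Qed.

Lemma submodN u : S u -> S (- u).
Proof. by rewrite -scaleN1r; exact: submodZ. Qed.

Lemma submodB u v : S u -> S v -> S (u - v).
Proof. by move=> Su Sv; apply: submodD => //; exact: submodN. Qed.

Lemma submod_sum I (s : seq I) (f : I -> A) :
  (forall i, S (f i)) -> S (\sum_(i <- s) f i).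
Proof.
by move=> Sf; elim/big_rec: _ => [|i u _]; [exact: submod0 | exact: submodD].
Qed.

Lemma submod_subl u v : S (u - v) -> S v -> S u.
Proof. by move=> Suv Sv; rewrite -(subrK v u); exact: submodD. Qed.

End Submod.

Lemma submodT A : submod (fun _ : A => True). Proof. by []. Qed.

Lemma submod_eq0 A : submod (fun x : A => x = 0).
Proof. by split=> // a u v -> ->; rewrite scaler0 addr0. Qed.

Lemma submod_preim A X (u : {linear A -> X}) (S : X -> Prop) :
  submod S -> submod (fun c => S (u c)).
Proof.
move=> hS; split=> [|a c d Sc Sd]; first by rewrite linear0; exact: submod0.
by rewrite linearP; apply: hS.2.
Qed.

Lemma linear_of X Y (f : X -> Y) :
  (forall a u v, f (a *: u + v) = a *: f u + f v) ->
  {u : {linear X -> Y} | u =1 f}.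
Proof.
move=> lf; pose m := GRing.isLinear.Build R X Y *:%R f lf.
pose u : {linear X -> Y} := HB.pack f m.
by exists u.
Qed.

(** Homomorphisms are often found as graphs, which are easier to enlarge and to
    unite than functions. *)
Lemma linear_of_rel X Y (G : X -> Y -> Prop) :
  (forall x, exists y, G x y) ->
  (forall a x x' y y', G x y -> G x' y' -> G (a *: x + x') (a *: y + y')) ->
  (forall y, G 0 y -> y = 0) ->
  exists u : {linear X -> Y}, forall x, G x (u x).
Proof.
move=> Gtot Glin G0; have [f fP] := choice Gtot.
have Gfun x y y' : G x y -> G x y' -> y = y'.
  move=> Gy Gy'; have := G0 (-1 *: y + y').
  rewrite scaleN1r => H; apply/esym/eqP; rewrite -subr_eq0 addrC; apply/eqP/H.
  by have := Glin (-1) _ _ _ _ Gy Gy'; rewrite !scaleN1r addNr.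
have [|u uE] := linear_of (f := f); last by exists u => x; rewrite uE.
by move=> a u v; apply: (Gfun (a *: u + v)) => //; apply: Glin.
Qed.

(** The quotient V/N, with a projection that is meaningful on V only and a choice
    of representatives. *)
Definition is_subquot A (V N : A -> Prop) (Q : lmodType R)
    (pi : A -> Q) (rep : Q -> A) :=
  [/\ forall a u v, V u -> V v -> pi (a *: u + v) = a *: pi u + pi v,
      forall u, V u -> (pi u = 0 <-> N u),
      forall q, V (rep q) & forall q, pi (rep q) = q].

(** The carrier consists of one chosen representative for each coset. *)
Lemma subquot_exists A (V N : A -> Prop) :
  submod V -> submod N -> (forall x, N x -> V x) ->
  exists (Q : lmodType R) (pi : A -> Q) (rep : Q -> A), is_subquot V N pi rep.
Proof.
move=> hV hN NV.
pose canon x := xget 0 (fun y => V y /\ N (y - x)).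
have canonP x : V x -> V (canon x) /\ N (canon x - x).
  move=> Vx; rewrite /canon; case: xgetP => [y _ //|/(_ x) []].
  by rewrite subrr; split => //; exact: submod0.
have canonE x y : N (x - y) -> canon x = canon y.
  move=> Nxy; rewrite /canon; congr (xget _ _); apply/funext => z.
  apply/propext; split=> -[Vz Nz]; split=> //.
    by rewrite -(subrK x z) -addrA; exact: submodD.
  rewrite -(subrK y z) -addrA; apply: submodD => //.
  by rewrite -opprB; exact: submodN.
pose Q0 := {x : A | V x /\ canon x = x}.
have canonK x : V x -> V (canon x) /\ canon (canon x) = canon x.
  by move=> Vx; have [Vc Nc] := canonP x Vx; split => //; exact: canonE.
pose pi0 x : Q0 := if pselect (V x) is left Vx then exist _ _ (canonK x Vx)
                   else exist _ _ (canonK 0 (submod0 hV)).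
pose rep0 (q : Q0) : A := proj1_sig q.
have V_rep q : V (rep0 q) by case: q => x [].
have rep_pi x : V x -> rep0 (pi0 x) = canon x.
  by move=> Vx; rewrite /pi0; case: pselect.
have rep_inj q q' : rep0 q = rep0 q' -> q = q'.
  by case: q q' => [x Hx] [y Hy] /= exy; exact: eq_exist.
have pi_rep q : pi0 (rep0 q) = q.
  by apply: rep_inj; rewrite rep_pi //; case: q => x [].
have N_rep x : V x -> N (rep0 (pi0 x) - x).
  by move=> Vx; rewrite rep_pi //; case: (canonP x Vx).
have pi_eq x y : V x -> V y -> N (x - y) -> pi0 x = pi0 y.
  by move=> Vx Vy Nxy; apply: rep_inj; rewrite !rep_pi //; exact: canonE.
pose add q q' := pi0 (rep0 q + rep0 q').
pose opp q := pi0 (- rep0 q).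
pose scl a q := pi0 (a *: rep0 q).
have VD u v : V u -> V v -> V (u + v) by exact: submodD.
have VN u : V u -> V (- u) by exact: submodN.
have VZ a u : V u -> V (a *: u) by exact: submodZ.
have piD u v : V u -> V v -> pi0 (u + v) = add (pi0 u) (pi0 v).
  move=> Vu Vv; apply: pi_eq; [exact: VD|exact: VD|].
  rewrite opprD addrACA; apply: submodD => //.
    by rewrite -opprB; apply: submodN => //; exact: N_rep.
  by rewrite -opprB; apply: submodN => //; exact: N_rep.
have piN u : V u -> pi0 (- u) = opp (pi0 u).
  move=> Vu; apply: pi_eq; [exact: VN|exact: VN|].
  by rewrite opprK addrC; exact: N_rep.
have piZ a u : V u -> pi0 (a *: u) = scl a (pi0 u).
  move=> Vu; apply: pi_eq; [exact: VZ|exact: VZ|].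
  rewrite -scalerBr -opprB; apply: (submodZ hN); apply: (submodN hN).
  exact: N_rep.
have addA : associative add.
  move=> p q r; rewrite -[p]pi_rep -[q]pi_rep -[r]pi_rep.
  by rewrite -!piD ?addrA //; exact: VD.
have addC : commutative add by move=> p q; rewrite /add addrC.
have add0 : left_id (pi0 0) add.
  move=> p; rewrite -[p in LHS]pi_rep -piD ?add0r ?pi_rep //; exact: submod0.
have addN : left_inverse (pi0 0) opp add.
  move=> p; rewrite -[p in LHS]pi_rep -piN // -piD ?addNr //; exact: VN.
have sclA a b p : scl a (scl b p) = scl (a * b) p.
  by rewrite -[p]pi_rep -!piZ ?scalerA //; exact: VZ.
have scl1 p : scl 1 p = p.
  by rewrite -[p]pi_rep -piZ // scale1r.
have sclDr : right_distributive scl add.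
  move=> a p q; rewrite -[p]pi_rep -[q]pi_rep -piD // -!piZ //; last exact: VD.
  by rewrite scalerDr piD //; exact: VZ.
have sclDl p a b : scl (a + b) p = add (scl a p) (scl b p).
  by rewrite -[p]pi_rep -?piZ // scalerDl piD //; exact: VZ.
pose m1 := gen_eqMixin Q0.
pose m2 := gen_choiceMixin Q0.
pose cT : choiceType := HB.pack Q0 m1 m2.
pose zT : zmodType :=
  HB.pack (Choice.sort cT) (GRing.isZmodule.Build cT addA addC add0 addN).
pose Q : lmodType R :=
  HB.pack (GRing.Zmodule.sort zT)
    (GRing.Zmodule_isLmodule.Build R zT sclA scl1 sclDr sclDl).
exists Q, pi0, rep0; split => //.
  move=> a u v Vu Vv; rewrite piD ?piZ //; exact: VZ.
move=> u Vu; split=> [u0|Nu].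
  have : N (rep0 (pi0 u) - rep0 (pi0 0)).
    by rewrite u0 subrr; exact: submod0.
  rewrite -[rep0 (pi0 u)](subrK u) -[rep0 (pi0 0)](subr0 (rep0 (pi0 0))).
  move=> Nx; rewrite -[u](addKr (rep0 (pi0 u) - u)).
  apply: submodD => //; first by apply: submodN => //; exact: N_rep.
  rewrite -[_ + u](subrK (rep0 (pi0 0) - 0)); apply: submodD => //.
  by apply: N_rep; exact: submod0.
by apply: pi_eq => //; rewrite ?subr0 //; exact: submod0.
Qed.

Section Subquot.
Variables (A : lmodType R) (V N : A -> Prop) (Q : lmodType R).
Variables (pi : A -> Q) (rep : Q -> A).
Hypotheses (hV : submod V) (hN : submod N) (hQ : is_subquot V N pi rep).

Lemma subquot0 : pi 0 = 0.
Proof. by have [_ pi0 _ _] := hQ; apply/pi0; exact: submod0. Qed.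

Lemma subquotZ a u : V u -> pi (a *: u) = a *: pi u.
Proof.
have [piP _ _ _] := hQ.
by move=> Vu; rewrite -[a *: u]addr0 piP ?subquot0 ?addr0 //; exact: submod0.
Qed.

Lemma subquotD u v : V u -> V v -> pi (u + v) = pi u + pi v.
Proof.
by have [piP _ _ _] := hQ => Vu Vv; rewrite -[u]scale1r piP // !scale1r.
Qed.

Lemma subquot_sum I (s : seq I) (f : I -> A) :
  (forall i, V (f i)) -> pi (\sum_(i <- s) f i) = \sum_(i <- s) pi (f i).
Proof.
move=> Vf; elim: s => [|i s IH]; rewrite ?big_nil ?big_cons ?subquot0 //.
by rewrite subquotD ?IH //; exact: submod_sum.
Qed.

Lemma subquot_eq u v : V u -> V v -> (pi u = pi v <-> N (u - v)).
Proof.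
have [_ pi0 _ _] := hQ => Vu Vv.
have -> : u - v = -1 *: v + u by rewrite scaleN1r addrC.
have Vw : V (-1 *: v + u) by exact: hV.2.
have VN : V (-1 *: v) by exact: submodZ.
rewrite -pi0 // subquotD // subquotZ // scaleN1r.
by split=> [->|/eqP]; rewrite addrC ?subrr // subr_eq0 => /eqP.
Qed.

End Subquot.
End Modules.

Section Free.
Variable R : pzRingType.

(** * Free modules *)

Section Construction.
Variable T : Type.
Implicit Types M X : lmodType R.

Definition comb (M : lmodType R) (h : T -> M) (s : seq (R * T)) : M :=
  \sum_(p <- s) p.1 *: h p.2.

Lemma comb_cat M (h : T -> M) s s' : comb h (s ++ s') = comb h s + comb h s'.
Proof. by rewrite /comb big_cat. Qed.

Lemma comb_scale M (h : T -> M) a s :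
  comb h [seq (a * p.1, p.2) | p <- s] = a *: comb h s.
Proof.
by rewrite /comb big_map scaler_sumr; apply: eq_bigr => p _; rewrite scalerA.
Qed.

Lemma comb_linear M X (u : {linear M -> X}) (h : T -> M) s :
  u (comb h s) = comb (u \o h) s.
Proof. by rewrite /comb linear_sum; apply: eq_bigr => p _; rewrite linearZ. Qed.

Let dirac (t : T) : T -> R^o := fun s => (`[< t = s >])%:R.

(** Group the terms by their generator: the coefficients of each one add up to
    zero. *)
Let comb_eq0 (M : lmodType R) (h : T -> M) s : comb dirac s = 0 -> comb h s = 0.
Proof.
move=> s0; pose sndc (p : R * T) : {classic T} := p.2.
pose U := undup [seq sndc p | p <- s].
have -> : comb h s = \sum_(p <- s) \sum_(t <- U | t == sndc p) p.1 *: h (t : T).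
  rewrite /comb; apply: (@eq_big_seq _ _ _ (R * {classic T})%type) => p ps.
  have pU : sndc p \in U.
    by rewrite mem_undup; exact: (@map_f (R * {classic T})%type _ sndc s p).
  rewrite big_mkcond (bigD1_seq (sndc p)) ?undup_uniq //= eqxx.
  by rewrite big1 ?addr0 // => t /negPf ->.
rewrite (exchange_big_dep predT) //=; apply: big1 => t _.
rewrite -scaler_suml [X in X *: _](_ : _ = 0) ?scale0r //.
have E : comb dirac s (t : T) = 0 by rewrite s0.
rewrite /comb fct_sumE in E; rewrite -[RHS]E.
rewrite big_mkcond; apply: eq_bigr => p _ /=.
rewrite /GRing.scale/= /dirac; case: eqP => [pt|npt].
  by rewrite (asboolT (esym pt)); exact: (esym (mulr1 _)).
by rewrite asboolF ?scaler0 // => /esym.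
Qed.

(** The free module is the span of the indicator functions in the module of all
    functions from T to R. *)
Lemma free_exists : exists (F : lmodType R) (e : T -> F),
  (forall x, exists s, x = comb e s) /\
  forall (M : lmodType R) (h : T -> M),
    exists u : {linear F -> M}, forall t, u (e t) = h t.
Proof.
pose V (f : T -> R^o) := exists s, f = comb dirac s.
have hV : submod V.
  split=> [|a _ _ [s ->] [s' ->]]; first by exists [::]; rewrite /comb big_nil.
  by exists ([seq (a * p.1, p.2) | p <- s] ++ s'); rewrite comb_cat comb_scale.
have [|Q [pi [rep [piP pi0 V_rep pi_rep]]]] := subquot_exists hV (submod_eq0 _).
  by move=> _ ->; exact: submod0.
have dV t : V (dirac t).
  by exists [:: (1, t)]; rewrite /comb big_seq1 scale1r.
have pi_comb s : pi (comb dirac s) = comb (pi \o dirac) s.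
  elim: s => [|p s IH]; rewrite /comb ?big_nil ?big_cons /=.
    by apply/pi0 => //; exact: submod0.
  by rewrite piP ?IH //; exists s.
exists Q, (pi \o dirac); split=> [q|M h].
  by have [s sE] := V_rep q; exists s; rewrite -pi_comb -sE pi_rep.
have [||q|u uP] := @linear_of_rel _ _ _
  (fun q m => exists s, q = comb (pi \o dirac) s /\ m = comb h s).
- move=> q; have [s sE] := V_rep q; exists (comb h s), s.
  by rewrite -pi_comb -sE pi_rep.
- move=> a _ _ _ _ [s [-> ->]] [s' [-> ->]].
  by exists ([seq (a * p.1, p.2) | p <- s] ++ s'); rewrite !comb_cat !comb_scale.
- by case=> s [/esym s0 ->]; apply: comb_eq0; rewrite -pi_comb in s0;
    apply/(pi0 _ _).1 => //; exists s.
exists u => t; have [s [es ->]] := uP (pi (dirac t)).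
have st : comb dirac ((- 1, t) :: s) = 0.
  apply/(pi0 _ _).1; first by exists ((- 1, t) :: s).
  rewrite pi_comb /comb big_cons [X in _ + X](_ : _ = pi (dirac t)).
    by rewrite scaleN1r addNr.
  by rewrite [RHS]es.
have := comb_eq0 h st; rewrite {1}/comb big_cons /= scaleN1r addrC => /eqP.
by rewrite subr_eq0 => /eqP.
Qed.

Definition freemod : lmodType R := projT1 (cid free_exists).
Definition free_gen : T -> freemod := projT1 (cid (projT2 (cid free_exists))).

Lemma free_comb (x : freemod) : exists s, x = comb free_gen s.
Proof. exact: (projT2 (cid (projT2 (cid free_exists)))).1. Qed.

Lemma free_lift_exists (M : lmodType R) (h : T -> M) :
  exists u : {linear freemod -> M}, forall t, u (free_gen t) = h t.
Proof. exact: (projT2 (cid (projT2 (cid free_exists)))).2. Qed.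

Definition free_lift (M : lmodType R) (h : T -> M) : {linear freemod -> M} :=
  projT1 (cid (free_lift_exists h)).

Lemma free_liftE (M : lmodType R) (h : T -> M) t : free_lift h (free_gen t) = h t.
Proof. by rewrite /free_lift; case: cid => u /=. Qed.

Lemma free_ext (M : lmodType R) (u v : {linear freemod -> M}) :
  (forall t, u (free_gen t) = v (free_gen t)) -> u =1 v.
Proof.
move=> uv x; have [s ->] := free_comb x; rewrite !comb_linear.
by apply: eq_bigr => p _ /=; rewrite uv.
Qed.

End Construction.

Lemma free_projective T : projective (freemod T).
Proof.
move=> A B g f gS; have [a aP] := choice (fun t => gS (f (free_gen t))).
exists (free_lift a) => x; rewrite /=.
by apply: (@free_ext T _ (g \o free_lift a) f) => t; rewrite /= free_liftE.
Qed.

End Free.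

Section Systems.
Variable R : pzRingType.
Implicit Types (A M X Y : lmodType R) (T : Type).

(** * Finite linear systems *)

Definition mxact A m k (B : 'M[R]_(m, k)) (x : 'I_k -> A) (i : 'I_m) : A :=
  \sum_j B i j *: x j.

Lemma mxactB A m k (B : 'M[R]_(m, k)) (x y : 'I_k -> A) i :
  mxact B (fun j => x j - y j) i = mxact B x i - mxact B y i.
Proof. by rewrite /mxact -sumrB; apply: eq_bigr => j _; rewrite scalerBr. Qed.

Lemma mxactD A m k (B : 'M[R]_(m, k)) (x y : 'I_k -> A) i :
  mxact B (fun j => x j + y j) i = mxact B x i + mxact B y i.
Proof. by rewrite /mxact -big_split; apply: eq_bigr => j _; rewrite scalerDr. Qed.

Lemma mxactM A m k l (B : 'M[R]_(m, k)) (C : 'M[R]_(k, l)) (y : 'I_l -> A) i :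
  mxact B (mxact C y) i = mxact (B *m C) y i.
Proof.
rewrite /mxact; under eq_bigr do rewrite scaler_sumr.
rewrite exchange_big; apply: eq_bigr => j _.
by rewrite mxE scaler_suml; apply: eq_bigr => h _; rewrite scalerA.
Qed.

Lemma mxact_fun A I m k (B : 'M[R]_(m, k)) (x : 'I_k -> I -> A) i t :
  mxact B x i t = mxact B (fun j => x j t) i.
Proof. by rewrite /mxact fct_sumE. Qed.

Lemma mxact_linear A X (u : {linear A -> X}) m k (B : 'M[R]_(m, k))
    (x : 'I_k -> A) i :
  u (mxact B x i) = mxact B (fun j => u (x j)) i.
Proof. by rewrite /mxact linear_sum; apply: eq_bigr => j _; rewrite linearZ. Qed.

Lemma mxact_submod A (S : A -> Prop) m k (B : 'M[R]_(m, k)) (x : 'I_k -> A) i :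
  submod S -> (forall j, S (x j)) -> S (mxact B x i).
Proof. by move=> hS Sx; apply: submod_sum => // j; exact: submodZ. Qed.

Lemma mxact_subquot A (V N : A -> Prop) (Q : lmodType R) (pi : A -> Q) rep m k
    (B : 'M[R]_(m, k)) (x : 'I_k -> A) i :
  submod V -> submod N -> is_subquot V N pi rep -> (forall j, V (x j)) ->
  pi (mxact B x i) = mxact B (fun j => pi (x j)) i.
Proof.
move=> hV hN hQ Vx; rewrite /mxact (subquot_sum hV hN hQ); last first.
  by move=> j; exact: submodZ.
by apply: eq_bigr => j _; rewrite (subquotZ hV hN hQ).
Qed.

Variable D : forall m k l, 'M[R]_(m, k) -> 'M[R]_(k, l) -> Prop.
Hypothesis D0 : forall m k l (B : 'M[R]_(m, k)) (C : 'M[R]_(k, l)),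
  D B C -> B *m C = 0.

(** The quotient V/N passes every test of [D].  Working with numerators and
    denominators avoids forming the quotient. *)
Definition solves A (V N : A -> Prop) :=
  forall m k l (B : 'M[R]_(m, k)) (C : 'M[R]_(k, l)), D B C ->
  forall x : 'I_k -> A, (forall j, V (x j)) -> (forall i, N (mxact B x i)) ->
  exists2 y : 'I_l -> A, forall j, V (y j) & forall j, N (x j - mxact C y j).

Definition testable M := solves (fun _ : M => True) (fun x => x = 0).

Lemma test_mxact0 A m k l (B : 'M[R]_(m, k)) (C : 'M[R]_(k, l)) (y : 'I_l -> A) i :
  D B C -> mxact B (mxact C y) i = 0.
Proof.
move=> /D0 BC; rewrite mxactM BC /mxact big1 // => j _.
by rewrite mxE scale0r.
Qed.

Lemma testable_subquot A (V N : A -> Prop) (Q : lmodType R) (pi : A -> Q) rep :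
  submod V -> submod N -> is_subquot V N pi rep -> solves V N -> testable Q.
Proof.
move=> hV hN hQ VN m k l B C DBC x _ Bx.
have [_ pi0 V_rep pi_rep] := hQ.
have [||y Vy Ny] := VN m k l B C DBC (rep \o x); first by move=> j /=.
  move=> i; apply/pi0; first by apply: mxact_submod => // j; exact: V_rep.
  rewrite (mxact_subquot _ _ hV hN hQ) //= -[RHS](Bx i).
  by apply: eq_bigr => j _; rewrite pi_rep.
exists (pi \o y) => // j; apply/eqP; rewrite subr_eq0; apply/eqP.
rewrite -[x j]pi_rep -(mxact_subquot _ _ hV hN hQ) //.
by apply/(subquot_eq hV hN hQ); [exact: V_rep|exact: mxact_submod|exact: Ny].
Qed.

(** * Small solution-closed submodules *)

(** Formal names for the elements of the smallest submodule that contains the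
    generators and a chosen solution of each solvable finite system with right
    hand side in it.  The type depends on the generators only, which bounds the
    size of this submodule independently of the ambient module. *)
Inductive term (G : Type) : Type :=
| Var (v : G)
| Zero
| Add (s t : term G)
| Scale (a : R) (t : term G)
| Solve m k (B : 'M[R]_(m, k)) (b : 'I_m -> term G) (j : 'I_k).

Section Purification.
Variables (X : lmodType R) (S : X -> Prop) (G : Type) (y : G -> X).
Hypotheses (hS : submod S) (XS : solves (fun _ => True) S).

Definition solution m k (B : 'M[R]_(m, k)) (b : 'I_m -> X) : 'I_k -> X :=
  xget (fun _ => 0) (fun z => forall i, S (mxact B z i - b i)).

Fixpoint eval (t : term G) : X :=
  match t with
  | Var v => y v
  | Zero => 0
  | Add s t => eval s + eval t
  | Scale a t => a *: eval t
  | Solve m k B b j => solution B (fun i => eval (b i)) j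
  end.

Let Y := free_lift eval.

Lemma free_lift_eval c : exists t, Y c = eval t.
Proof.
have [s ->] := free_comb c; rewrite comb_linear.
elim: s => [|p s [t tE]]; rewrite /comb ?big_nil ?big_cons; first by exists (@Zero G).
by exists (Add (Scale p.1 p.2) t); rewrite /= /Y free_liftE -tE.
Qed.

(** Modulo S, the image of Y is a pure submodule: a finite system with right hand
    side in it is solvable in it as soon as it is solvable. *)
Lemma eval_pure m k (B : 'M[R]_(m, k)) (c : 'I_m -> freemod R (term G)) (z : 'I_k -> X) :
  (forall i, S (mxact B z i - Y (c i))) ->
  exists d : 'I_k -> freemod R (term G), forall i, S (mxact B (Y \o d) i - Y (c i)).
Proof.
move=> Bz; have [b bE] := choice (fun i => free_lift_eval (c i)).
exists (fun j => free_gen R (Solve B b j)) => i.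
have -> : mxact B (Y \o (fun j => free_gen R (Solve B b j))) i =
          mxact B (solution B (fun i => eval (b i))) i.
  by apply: eq_bigr => j _; rewrite /= /Y free_liftE.
rewrite bE /solution; case: xgetP => [z' _ z'P|/(_ z) []] //.
by move=> i'; rewrite -bE.
Qed.

(** Downward Loewenheim-Skolem for testable quotients X/S: with Y the evaluation
    of terms, the submodule (S + im Y)/S of X/S and its quotient X/(S + im Y) are
    testable.  For the submodule, the solution of a test in X/S can be moved into
    it by purity.  For the quotient, purity allows one to correct x by an element
    of im Y so that B x = 0 holds modulo S. *)
Lemma purify :
  exists Y : {linear freemod R (term G) -> X},
  [/\ forall v, Y (free_gen R (Var v)) = y v,
      solves (fun _ => True) (fun c => S (Y c)) &
      solves (fun _ => True) (fun x => exists s c, S s /\ x = s + Y c)].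
Proof.
exists Y; split=> [v|m k l B C DBC c _ Bc|m k l B C DBC x _ Bx].
- by rewrite /Y free_liftE.
- have [//|i|z _ Cz] := XS DBC (x := Y \o c); first by rewrite -mxact_linear.
  have [j|d dP] := eval_pure (B := C) (c := c) (z := z).
    by rewrite -opprB; apply: (submodN hS); exact: Cz.
  exists d => // j; rewrite linearB mxact_linear -opprB; apply: submodN => //.
have [s sP] := choice Bx; have [c cP] := choice sP.
have [i|d dP] := eval_pure (B := B) (c := c) (z := x).
  by have [Ss ->] := cP i; rewrite addrK.
have [//|i|z _ Cz] := XS DBC (x := fun j => x j - Y (d j)).
  have [Ss xE] := cP i; rewrite mxactB xE -addrA -[Y _ - _]opprB.
  by apply: submodB => //; exact: dP.
exists z => // j; exists (x j - Y (d j) - mxact C z j), (d j); split => //.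
by rewrite addrAC subrK.
Qed.

End Purification.

(** * Preenvelopes *)

(** The index set [I] consists of the maps from M to testable quotients of the free
    module on the terms over M; the quotients are given by the submodules
    factored out, and the maps by representatives, so that [I] is a small set. *)
Lemma testable_preenveloping : preenveloping testable.
Proof.
move=> M; pose T := freemod R (term M).
pose I := {i : (T -> Prop) * (M -> T) | [/\ submod i.1,
   solves (fun _ => True) i.1 & forall a u v,
     i.1 (i.2 (a *: u + v) - (a *: i.2 u + i.2 v))]}.
pose N (a : I -> T) := forall i, (sval i).1 (a i).
have hN : submod N.
  split=> [i|a u v Nu Nv i]; have [hK _ _] := svalP i; first exact: submod0.
  exact: hK.2 (Nu i) (Nv i).
have [//|Q [pi [rep hQ]]] := subquot_exists (@submodT _ (I -> T)) hN.
have QX : testable Q.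
  apply: testable_subquot hQ _ => // m k l B C DBC x _ Bx.
  have sol (i : I) : exists y, forall j, (sval i).1 (x j i - mxact C y j).
    have [hK XK _] := svalP i.
    have [//|h|y _ yP] := XK _ _ _ _ _ DBC (fun j => x j i).
      by rewrite -mxact_fun; exact: Bx.
    by exists y.
  have [y yP] := choice sol.
  exists (fun j i => y i j) => // j i.
  change ((sval i).1 (x j i - mxact C (fun j i => y i j) j i)).
  by rewrite mxact_fun; exact: yP.
have [|phi phiE] := linear_of (f := fun u : M => pi (fun i : I => (sval i).2 u)).
  move=> a u v; have [piP _ _ _] := hQ; rewrite -piP //.
  by apply/(subquot_eq _ hN hQ) => // -[[K r]] [hK XK rP]; exact: rP.
exists Q, phi; split=> // E f EX.
have [Y [YV YK _]] := purify f (@submod_eq0 _ E) EX.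
pose K c := Y c = 0; pose r (u : M) := free_gen R (Var u).
have iP : [/\ submod K, solves (fun _ => True) K & forall a u v,
     K (r (a *: u + v) - (a *: r u + r v))].
  split=> //; first exact: submod_preim (@submod_eq0 _ E).
  by move=> a u v; rewrite /K linearB linearP !YV linearP subrr.
pose i : I := exist _ (K, r) iP.
have [_ pi0 _ pi_rep] := hQ.
have [|u uE] := linear_of (f := fun q => Y (rep q i)).
  move=> a p q; rewrite -linearP; apply/eqP; rewrite -subr_eq0 -linearB; apply/eqP.
  have : N (rep (a *: p + q) - (a *: rep p + rep q)).
    apply/(subquot_eq _ hN hQ) => //; have [piP _ _ _] := hQ.
    by rewrite piP // !pi_rep.
  by move/(_ i).
exists u => x; rewrite /= uE phiE -YV; apply/eqP; rewrite -subr_eq0 -linearB; apply/eqP.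
have : N (rep (pi (fun i => (sval i).2 x)) - (fun i => (sval i).2 x)).
  by apply/(subquot_eq _ hN hQ) => //; rewrite pi_rep.
by move/(_ i).
Qed.

(** * Attaching cells: an analogue of the small object argument *)

Section Unions.
Variables (A : lmodType R) (I : Type) (J : I -> Prop) (V N : I -> A -> Prop).
Hypothesis J0 : exists i, J i.
Let le i k := (V i `<=` V k)%classic /\ (N i `<=` N k)%classic.
Hypothesis dir : forall i j, J i -> J j -> exists k, [/\ J k, le i k & le j k].

Let leT i j k : le i j -> le j k -> le i k.
Proof.
move=> [Vij Nij] [Vjk Njk]; split; first exact: subset_trans Vjk.
exact: subset_trans Njk.
Qed.

Lemma union_submod : (forall i, J i -> submod (V i)) ->
  submod (fun x => exists2 i, J i & V i x).
Proof.
move=> hV; split=> [|a x y [i Ji Vx] [j Jj Vy]].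
  by case: J0 => i Ji; exists i => //; exact: submod0 (hV i Ji).
have [k [Jk [ik _] [jk _]]] := dir Ji Jj.
by exists k => //; apply: (hV k Jk).2; [exact: ik | exact: jk].
Qed.

(** A tuple and the finitely many equations that it satisfies live at one stage of
    a directed system; so testability passes to directed colimits. *)
Lemma union_solves : (forall i, J i -> solves (V i) (N i)) ->
  solves (fun x => exists2 i, J i & V i x) (fun x => exists2 i, J i & N i x).
Proof.
move=> VN m k l B C DBC x Vx NBx.
have [f fP] := choice (fun j => let: ex_intro2 i Ji Vi := Vx j in
  ex_intro (fun i => J i /\ V i (x j)) i (conj Ji Vi)).
have [g gP] := choice (fun j => let: ex_intro2 i Ji Vi := NBx j in
  ex_intro (fun i => J i /\ N i (mxact B x j)) i (conj Ji Vi)).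
have [p Jp fp] := directed_fin J0 leT dir (fun j => (fP j).1).
have [q Jq gq] := directed_fin J0 leT dir (fun j => (gP j).1).
have [i [Ji [pi _] [_ qi]]] := dir Jp Jq.
have [j|j|y Vy Ny] := VN i Ji m k l B C DBC x.
- by apply: pi; apply: (fp j).1; case: (fP j).
- by apply: qi; apply: (gq j).2; case: (gP j).
by exists y => j; exists i.
Qed.
End Unions.

Section SmallObject.
Variables (T : Type) (M : lmodType R).
Let E := freemod R T.

(** A problem consists of a subset K of the free module E on T, a map from K to the
    module W under construction, and a map h from T to M; in a valid problem K is a
    submodule and h, extended to E, extends the composite of K -> W -> M.  Solving
    it means to glue E to W along K.  The
    generators of W are the basis elements of the copies of E, one copy for each
    problem.  Elements of W are represented by lists here, for W is the free
    module on the very type that is being defined. *)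
Inductive cell : Type :=
  Cell (p : (freemod R T -> Prop) * (freemod R T -> seq (R * cell)) * (T -> M))
       (t : T).

Definition problem : Type := (E -> Prop) * (E -> seq (R * cell)) * (T -> M).
Let W := freemod R cell.

Definition attach (p : problem) (c : E) : W :=
  comb (free_gen R (T := cell)) (p.1.2 c).
Definition incl (p : problem) : {linear E -> W} :=
  free_lift (fun t => free_gen R (Cell p t)).
(** The component of an element of W in the copy of E that belongs to p. *)
Definition proj (p : problem) : {linear W -> E} :=
  free_lift (fun c => let: Cell q t := c in
    if pselect (q = p) then free_gen R t else 0).
Definition target : {linear W -> M} :=
  free_lift (fun c => let: Cell p t := c in p.2 t).

Lemma proj_incl p c : proj p (incl p c) = c.
Proof.
apply: (@free_ext R T _ (proj p \o incl p) idfun) => t.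
by rewrite /= /incl free_liftE /proj free_liftE; case: pselect.
Qed.

Lemma proj_incl_neq p q c : p <> q -> proj p (incl q c) = 0.
Proof.
move=> pq; apply: (@free_ext R T _ (proj p \o incl q) \0) => t.
by rewrite /= /incl free_liftE /proj free_liftE; case: pselect => // qp; case: pq.
Qed.

Lemma target_incl p c : target (incl p c) = free_lift p.2 c.
Proof.
apply: (@free_ext R T _ (target \o incl p) (free_lift p.2)) => t.
by rewrite /= /incl /target !free_liftE.
Qed.

Definition solved (V N : W -> Prop) (p : problem) :=
  (forall c, V (incl p c)) /\ forall c, p.1.1 c -> N (incl p c - attach p c).

(** A stage is a subquotient V/N of W.  The last clause says that each copy of E is
    either glued in already or not touched at all, in which case it is free to be
    glued in later. *)
Definition stage (V N : W -> Prop) :=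
  [/\ [/\ submod V, submod N & forall x, N x -> V x],
      forall x, N x -> target x = 0,
      solves V N &
      forall p, solved V N p \/ forall v, V v -> proj p v = 0].

Definition valid (V N : W -> Prop) (p : problem) :=
  [/\ submod p.1.1 /\ solves (fun _ => True) p.1.1,
      forall c, p.1.1 c -> V (attach p c),
      forall c, p.1.1 c -> target (attach p c) = free_lift p.2 c &
      forall a c d, p.1.1 c -> p.1.1 d ->
        N (attach p (a *: c + d) - (a *: attach p c + attach p d))].

(** The new stage is the pushout of V/N and E along K.  As the copy of E is
    untouched by V, the projection to it shows that no new relations arise in V;
    hence V'/N' is an extension of E/K by V/N, and passes the tests because both
    do. *)
Lemma attach_stage (V N : W -> Prop) p : stage V N -> valid V N p ->
  exists V' N', [/\ stage V' N', forall x, V x -> V' x,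
    forall x, N x -> N' x & solved V' N' p].
Proof.
move=> hVN; have [_ _ _ /(_ p) [sp _|fresh]] := hVN; first by exists V, N.
case: hVN => -[hV hN NV] Ntarget VN part [[hK KX] Vatt tatt linatt].
set K := p.1.1 in hK KX Vatt tatt linatt.
pose rel c := incl p c - attach p c.
have linrel a c d : K c -> K d -> N (rel (a *: c + d) - (a *: rel c + rel d)).
  move=> Kc Kd.
  have -> : a *: rel c + rel d =
            incl p (a *: c + d) - (a *: attach p c + attach p d).
    by rewrite /rel linearP scalerBr opprD addrACA.
  rewrite /rel opprB addrC subrKA.
  by rewrite -opprB; apply: submodN => //; exact: linatt.
have rel0 : N (rel 0).
  have := linrel 1 0 0 (submod0 hK) (submod0 hK).
  rewrite scaler0 add0r scale1r opprD addrA subrr add0r => /(submodN hN).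
  by rewrite opprK.
pose V' x := exists c, V (x - incl p c).
pose N' x := exists2 c, K c & N (x - rel c).
have hV' : submod V'.
  split=> [|a x y [c Vc] [d Vd]].
    by exists 0; rewrite linear0 subrr; exact: submod0.
  by exists (a *: c + d); rewrite linearP opprD addrACA -scalerBr; exact: hV.2.
have hN' : submod N'.
  split=> [|a x y [c Kc Nc] [d Kd Nd]].
    by exists 0; rewrite ?sub0r; [exact: submod0 | exact: submodN].
  exists (a *: c + d); first exact: hK.2.
  rewrite -(subrKA (a *: rel c + rel d)); apply: submodD => //.
    by rewrite opprD addrACA -scalerBr; exact: hN.2.
  by rewrite -opprB; apply: submodN => //; exact: linrel.
have VV' x : V x -> V' x by move=> Vx; exists 0; rewrite linear0 subr0.
have NN' x : N x -> N' x.
  by move=> Nx; exists 0; [exact: submod0 | exact: submodB].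
have proj_rel c : K c -> proj p (rel c) = c.
  by move=> Kc; rewrite linearB proj_incl fresh ?subr0 //; exact: Vatt.
have projN x c : K c -> N (x - rel c) -> proj p x = c.
  move=> Kc Nx; apply/eqP; rewrite -subr_eq0 -{1}(proj_rel c Kc) -linearB.
  by apply/eqP/fresh/NV.
have N'V x : N' x -> V x -> N x.
  move=> [c Kc Nx] Vx; have := projN _ _ Kc Nx; rewrite fresh // => c0.
  by apply: (submod_subl hN Nx); rewrite -c0.
have solp : solved V' N' p.
  split=> c; first by exists c; rewrite subrr; exact: submod0.
  by exists c => //; rewrite subrr; exact: submod0.
exists V', N'; split=> //; split.
- split=> // x [c Kc Nx]; exists c.
  rewrite (_ : x - _ = x - rel c - attach p c).
    by apply: submodB => //; [exact: NV|exact: Vatt].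
  by rewrite /rel opprB addrCA [RHS]addrC addKr.
- move=> x [c Kc Nx]; rewrite -(subrK (rel c) x) linearD (Ntarget _ Nx) add0r.
  by rewrite linearB target_incl tatt // subrr.
- move=> m k l B C DBC x V'x N'Bx; have [c Vc] := choice V'x.
  have [//|i|d _ Kd] := KX m k l B C DBC c.
    have [e Ke Ne] := N'Bx i; suff -> : mxact B c i = e by [].
    rewrite -(projN _ _ Ke Ne); apply/esym/eqP; rewrite -subr_eq0.
    rewrite -(proj_incl p (mxact B c i)) -linearB mxact_linear -mxactB.
    by apply/eqP/fresh; apply: mxact_submod => // j; exact: Vc.
  (* Correct x by elements of the new copy of E to make it a solution of the test
     in V/N; d is a solution of the test for its component c in E/K. *)
  pose kap j := c j - mxact C d j.
  pose z j := x j - mxact C (fun h => incl p (d h)) j - rel (kap j).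
  have Vz j : V (z j).
    rewrite /z -(mxact_linear (incl p)) /rel.
    have -> : incl p (kap j) = incl p (c j) - incl p (mxact C d j).
      by rewrite -linearB.
    rewrite opprB opprB addrCA subrKA addrC.
    by apply: submodD => //; apply: Vatt; exact: Kd.
  have [//|i|y Vy Ny] := VN m k l B C DBC z.
    apply: N'V; last exact: mxact_submod.
    rewrite 2!mxactB test_mxact0 // subr0.
    by apply: submodB => //; apply: mxact_submod => // j; apply: solp.2; exact: Kd.
  exists (fun h => incl p (d h) + y h) => j.
    by apply: submodD => //; [exact: solp.1 | exact: VV'].
  rewrite mxactD opprD addrA -(subrK (rel (kap j)) (_ - _)).
  apply: submodD => //; last by apply: solp.2; exact: Kd.
  by apply: NN'; rewrite addrAC; exact: Ny.
- move=> q; have [->|pq] := pselect (q = p); first by left.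
  have [[s1 s2]|fr] := part q; [left; split=> [c|c Kc]|right].
  + exact: VV'.
  + by apply: NN'; exact: s2.
  move=> x [c Vx]; rewrite -(subrK (incl p c) x) linearD fr //.
  by rewrite proj_incl_neq // addr0.
Qed.

(** All stages are subquotients of the fixed module W, so that Zorn's lemma takes the
    place of a transfinite iteration whose length depends on T and M. *)
Lemma maximal_stage : exists V N, stage V N /\
  forall p, valid V N p -> solved V N p.
Proof.
pose P (S : bool * W -> Prop) :=
  stage (fun x => S (true, x)) (fun x => S (false, x)).
have [||S PS Smax] := @zorn_sets _ P (fun x => x.2 = 0).
- split=> /=.
  + by split=> //; exact: submod_eq0.
  + by move=> _ ->; rewrite linear0.
  + move=> m k l B C _ x x0 _; exists (fun=> 0) => // j.
    by rewrite x0 sub0r /mxact big1 ?oppr0 // => i _; rewrite scaler0.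
  + by move=> p; right=> _ ->; rewrite linear0.
- move=> F F0 FP dir.
  pose slice b (S : bool * W -> Prop) x := S (b, x).
  have dir2 b c S S' : F S -> F S' -> exists S2, [/\ F S2,
      (slice b S `<=` slice b S2)%classic /\ (slice c S `<=` slice c S2)%classic &
      (slice b S' `<=` slice b S2)%classic /\ (slice c S' `<=` slice c S2)%classic].
    move=> FS FS'; have [S2 [FS2 SS2 S'S2]] := dir _ _ FS FS'.
    by exists S2; split=> //; split=> x Sx; by [exact: SS2 | exact: S'S2].
  split.
  + split.
    * by apply: (union_submod F0 (dir2 true false)) => S /FP [[]].
    * by apply: (union_submod F0 (dir2 false true)) => S /FP [[]].
    * move=> x [S FS Sx]; exists S => //.
      by have [[_ _ NV] _ _ _] := FP S FS; exact: NV.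
  + by move=> x [S FS Sx]; have [_ Nt _ _] := FP S FS; exact: Nt.
  + by apply: (union_solves F0 (dir2 true false)) => S /FP [].
  + move=> p; have [[S [FS [s1 s2]]]|ns] :=
      pselect (exists S, F S /\ solved (slice true S) (slice false S) p).
      left; split=> c; first by exists S => //; exact: s1.
      by move=> Kc; exists S => //; exact: s2.
    right=> v [S FS Sv]; have [_ _ _ part] := FP S FS.
    case: (part p) => [sp|]; last exact.
    by case: ns; exists S.
exists (fun x => S (true, x)), (fun x => S (false, x)); split=> // p vp.
have [V' [N' [st' VV' NN' sp]]] := attach_stage PS vp.
have sub := Smax (fun x => if x.1 then V' x.2 else N' x.2) st'.
have {}sub : ((fun x => if x.1 then V' x.2 else N' x.2) `<=` S)%classic.
  by apply: sub => -[[] x]; [exact: VV' | exact: NN'].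
split=> [c|c Kc]; first by apply: (sub (true, _)); exact: sp.1.
by apply: (sub (false, _)); exact: sp.2.
Qed.

(** C -> M has the right lifting property with respect to the inclusions of
    submodules K in E with testable quotient. *)
Lemma small_object : exists (C : lmodType R) (phi : {linear C -> M}),
  testable C /\
  forall (K : E -> Prop) (g : E -> C) (h : T -> M),
    submod K -> solves (fun _ => True) K ->
    (forall a c d, K c -> K d -> g (a *: c + d) = a *: g c + g d) ->
    (forall c, K c -> phi (g c) = free_lift h c) ->
    exists2 w : {linear E -> C}, forall c, K c -> w c = g c &
      forall c, phi (w c) = free_lift h c.
Proof.
have [V [N [[[hV hN NV] Nt VN _] VNmax]]] := maximal_stage.
have [C [pi [rep hC]]] := subquot_exists hV hN NV.
have [piP pi0 V_rep pi_rep] := hC.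
have target_pi u v : V u -> V v -> pi u = pi v -> target u = target v.
  move=> Vu Vv /(subquot_eq hV hN hC Vu Vv) /Nt.
  by rewrite linearB => /eqP; rewrite subr_eq0 => /eqP.
have [|phi phiE] := linear_of (f := fun q => target (rep q)).
  move=> a p q; rewrite -linearP; apply: target_pi => //; first exact: hV.2.
  by rewrite piP // !pi_rep.
exists C, phi; split; first exact: testable_subquot hC VN.
move=> K g h hK KX glin gh.
have [code codeE] := choice (fun c => free_comb (rep (g c))).
pose p : problem := (K, code, h).
have attE c : attach p c = rep (g c) by rewrite codeE.
have [|sV sN] := VNmax p.
  split=> //= [c Kc|c Kc|a c d Kc Kd].
  - by rewrite attE.
  - by rewrite attE -gh // phiE.
  rewrite !attE; apply/(subquot_eq hV hN hC) => //; first exact: hV.2.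
  by rewrite piP // !pi_rep glin.
have [|w wE] := linear_of (f := fun c => pi (incl p c)).
  by move=> a c d; rewrite linearP piP.
exists w => c; first move=> Kc; rewrite wE.
  rewrite -[g c]pi_rep -attE; apply/(subquot_eq hV hN hC) => //; last exact: sN.
  by rewrite attE.
by rewrite phiE -(target_incl p); apply: target_pi; rewrite ?pi_rep.
Qed.

End SmallObject.

(** * Precovers *)

Section Graphs.
Variables (M C X : lmodType R) (phi : {linear C -> M}) (f : {linear X -> M}).

Definition domain (G : X * C -> Prop) (x : X) := exists c, G (x, c).

(** The graph of a lift of f to C along phi, defined on a submodule of X.  Requiring
    that the quotient by the domain is testable makes it possible to apply
    [purify] to this quotient. *)
Definition partial_lift (G : X * C -> Prop) :=
  [/\ G (0, 0),
      forall a x x' c c', G (x, c) -> G (x', c') -> G (a *: x + x', a *: c + c'),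
      forall c, G (0, c) -> c = 0,
      forall x c, G (x, c) -> phi c = f x &
      solves (fun _ => True) (domain G)].

Lemma domain_submod G : partial_lift G -> submod (domain G).
Proof.
move=> [G0 Glin _ _ _]; split=> [|a x x' [c Gc] [c' Gc']]; first by exists 0.
by exists (a *: c + c'); exact: Glin.
Qed.

Lemma maximal_lift : testable X -> exists2 G, partial_lift G &
  forall G', partial_lift G' -> (G `<=` G')%classic -> (G' `<=` G)%classic.
Proof.
move=> XX; apply: (@zorn_sets _ _ (fun z => z = (0, 0))).
  split=> //.
  - by move=> a x x' c c' [-> ->] [-> ->]; rewrite !scaler0 !addr0.
  - by move=> c [].
  - by move=> x c [-> ->]; rewrite !linear0.
  - move=> m k l B E DBE x _ x0.
    have [//|i|y _ xy] := XX _ _ _ _ _ DBE x.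
      by have [c []] := x0 i.
    by exists y => // j; exists 0; rewrite xy.
move=> F F0 FP dir.
split.
- by have [G FG] := F0; exists G => //; have [] := FP G FG.
- move=> a x x' c c' [G FG Gx] [G' FG' Gx'].
  have [G2 [FG2 GG2 G'G2]] := dir _ _ FG FG'.
  exists G2 => //; have [_ lin _ _ _] := FP G2 FG2.
  by apply: lin; [exact: GG2 | exact: G'G2].
- by move=> c [G FG G0c]; have [_ _ fn _ _] := FP G FG; exact: fn.
- by move=> x c [G FG Gxc]; have [_ _ _ fn _] := FP G FG; exact: fn.
have -> : domain (fun x => exists2 G, F G & G x) =
          (fun x => exists2 G, F G & domain G x).
  apply/funext => x; apply/propext.
  by split=> [[c [G FG Gxc]]|[G FG [c Gxc]]]; [exists G => //; exists c|exists c, G].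
have -> : (fun _ : X => True) = (fun x => exists2 G, F G & True).
  by apply/funext => x; apply/propext; split=> // _; have [G FG] := F0; exists G.
apply: (union_solves (V := fun _ _ => True) F0) => [G G' FG FG'|G FG]; last first.
  by have [] := FP G FG.
have [G2 [FG2 GG2 G'G2]] := dir _ _ FG FG'.
by exists G2; split=> //; split=> // x [c Gxc]; exists c; [exact: GG2|exact: G'G2].
Qed.

End Graphs.

Lemma testable_precover M : exists (C : lmodType R) (phi : {linear C -> M}),
  is_precover testable phi.
Proof.
have [C [phi [CX ext]]] := small_object (term unit) M.
exists C, phi; split=> // X f XX.
have [G hG Gmax] := maximal_lift phi f XX.
have hdom := domain_submod hG.
have [G0 Glin Gfun Gphi GX] := hG.
have Guniq x c c' : G (x, c) -> G (x, c') -> c = c'.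
  move=> Gc Gc'; have := Glin (-1) _ _ _ _ Gc Gc'; rewrite !scaleN1r addNr.
  by move/Gfun; rewrite addrC => /eqP; rewrite subr_eq0 => /eqP.
suff Gtot x : domain G x.
  have lin a x x' c c' := Glin a x x' c c'.
  have [u uP] := linear_of_rel (G := fun x c => G (x, c)) Gtot lin Gfun.
  by exists u => x; exact: Gphi.
(* Enlarge the domain by a small submodule containing x; maximality of G then puts
   x in the domain of G. *)
have [Y [YV YK YX]] := purify (fun _ : unit => x) hdom GX.
have {}YV := YV tt.
pose K c := domain G (Y c).
have hK : submod K by exact: submod_preim.
have /choice[g gP] c : exists d, K c -> G (Y c, d).
  have [[d Gd]|nK] := pselect (K c); first by exists d.
  by exists 0 => /nK.
have [||w wg wY] := ext K g (fun t => f (Y (free_gen R t))) hK YK.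
- move=> a c d Kc Kd; apply: (Guniq (Y (a *: c + d))); first exact/gP/hK.2.
  by rewrite linearP; apply: Glin; exact: gP.
- move=> c Kc; rewrite (Gphi (Y c)); last exact: gP.
  apply: (@free_ext R _ _ (f \o Y) (free_lift _)) => t.
  by rewrite /= free_liftE.
pose G' (z : X * C) := exists x d c, [/\ G (x, d), z.1 = x + Y c & z.2 = d + w c].
have GG' : (G `<=` G')%classic.
  by move=> [z d] Gz; exists z, d, 0; rewrite !linear0 !addr0.
have G'y : G' (x, w (free_gen R (Var tt))).
  by exists 0, 0, (free_gen R (Var tt)); rewrite YV !add0r.
exists (w (free_gen R (Var tt))); apply: (Gmax G') => //; split.
- exact: GG'.
- move=> a z z' e e' [x0 [d [c [Gx /= -> ->]]]] [x1 [d' [c' [Gx' /= -> ->]]]].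
  exists (a *: x0 + x1), (a *: d + d'), (a *: c + c'); split; first exact: Glin.
    by rewrite /= linearP scalerDr addrACA.
  by rewrite /= linearP scalerDr addrACA.
- (* The two lifts agree where their domains meet, namely on the image of K. *)
  move=> e [z [d [c [Gz /= z0 ->]]]].
  have Kc : K c.
    exists (-1 *: d + 0); rewrite (_ : Y c = -1 *: z + 0); first exact: Glin.
    by rewrite scaleN1r addr0; apply/eqP; rewrite eq_sym -subr_eq0 -opprD -z0 oppr0.
  apply: Gfun; rewrite [0]z0 wg // -[z]scale1r -[d]scale1r.
  by apply: Glin => //; exact: gP.
- move=> z e [x0 [d [c [Gx /= -> ->]]]].
  rewrite !linearD (Gphi _ _ Gx) wY; congr (_ + _).
  apply/esym; apply: (@free_ext R _ _ (f \o Y) (free_lift _)) => t.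
  by rewrite /= free_liftE.
rewrite (_ : domain G' = fun x => exists s c, domain G s /\ x = s + Y c) //.
apply/funext => z; apply/propext; split.
  by move=> [e [x0 [d [c [Gx /= -> _]]]]]; exists x0, c; split=> //; exists d.
by move=> [s [c [[d Gs] ->]]]; exists (d + w c), s, d, c.
Qed.

(** * Covers *)

Section Endomorphisms.
Variables (M C : lmodType R) (phi : {linear C -> M}).
Hypothesis phiP : is_precover testable phi.

Definition over (f : C -> C) :=
  (forall a u v, f (a *: u + v) = a *: f u + f v) /\ phi \o f =1 phi.

Lemma over_id : over id. Proof. by split=> [a u v|u]. Qed.

Lemma over_comp f g : over f -> over g -> over (g \o f).
Proof.
move=> [lf pf] [lg pg]; split=> [a u v|u] /=; first by rewrite lf lg.
exact: etrans (pg (f u)) (pf u).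
Qed.

Lemma over0 f : over f -> f 0 = 0.
Proof. by move=> [lf _]; have := lf (-1) 0 0; rewrite !scaleN1r !addNr. Qed.

Lemma overB f u v : over f -> f (u - v) = f u - f v.
Proof. by move=> [lf _]; rewrite addrC -!scaleN1r lf addrC. Qed.

Lemma over_mxact f m k (B : 'M[R]_(m, k)) x i : over f ->
  f (mxact B x i) = mxact B (fun j => f (x j)) i.
Proof.
move=> hf; have [u uE] := linear_of hf.1; rewrite -uE mxact_linear.
by apply: eq_bigr => j _; rewrite uE.
Qed.

Section Colimit.
Variables (I : Type) (S : I -> I -> (C -> C) -> Prop).

Definition node i := S i i id.

(** In a chain, [S i j f] says that f is the transition map from the copy of C at i
    to the copy of C at j; the set of nodes in use is part of the relation, so that
    Zorn's lemma applies to chains as sets of triples. *)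
Definition chain :=
  [/\ forall i j f, S i j f -> [/\ node i, node j & over f],
      forall i j f g, S i j f -> S i j g -> f = g,
      forall i j k f g, S i j f -> S j k g -> S i k (g \o f) &
      forall i j, node i -> node j -> exists f, S i j f \/ S j i f].

Hypotheses (hS : chain) (S0 : exists i, node i).

Let le i j := exists f, S i j f.

Lemma chain_bound_fin n (i : 'I_n -> I) : (forall h, node (i h)) ->
  exists2 k, node k & forall h, le (i h) k.
Proof.
have [Snode _ Scomp Stot] := hS.
apply: (directed_fin (r := le) S0) => [j k l [f fS] [g gS]|j k Jj Jk].
  by exists (g \o f); exact: Scomp gS.
have [f [fS|fS]] := Stot j k Jj Jk; first by exists k; split=> //; [exists f|exists id].
by exists j; split=> //; [exists id|exists f].
Qed.

Lemma chain_bound i j : node i -> node j -> exists k, [/\ node k, le i k & le j k].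
Proof.
move=> Ji Jj; have [h|k Jk kP] := @chain_bound_fin 2 (fun h => if h == 0 then i else j).
  by case: ifP.
by exists k; split=> //; [exact: (kP 0) | exact: (kP 1)].
Qed.

(** The colimit is realized inside the functions from I to C, as the families that
    are eventually coherent modulo those that are eventually zero. *)
Definition thread i (a : I -> C) := node i /\ forall j f, S i j f -> a j = f (a i).
Definition dead i (a : I -> C) := node i /\ forall j f, S i j f -> a j = 0.

Lemma thread_le i j a : le i j -> thread i a -> thread j a.
Proof.
have [Snode _ Scomp _] := hS; move=> [f fS] [Ji ai].
have [_ Jj _] := Snode _ _ _ fS; split=> // k g gS.
by rewrite (ai _ _ fS) (ai _ _ (Scomp _ _ _ _ _ fS gS)).
Qed.

Lemma dead_le i j a : le i j -> dead i a -> dead j a.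
Proof.
have [Snode _ Scomp _] := hS; move=> [f fS] [Ji ai].
have [_ Jj _] := Snode _ _ _ fS; split=> // k g gS.
exact: ai (Scomp _ _ _ _ _ fS gS).
Qed.

Lemma thread_submod : submod (fun a => exists i, thread i a).
Proof.
have [Snode _ _ _] := hS; split=> [|b u v [i iu] [j jv]].
  have [i Ji] := S0; exists i; split=> // j f fS.
  by have [_ _ hf] := Snode _ _ _ fS; rewrite over0.
have [k [Jk ik jk]] := chain_bound iu.1 jv.1.
exists k; split=> // l f fS; have [_ _ [lf _]] := Snode _ _ _ fS.
have [_ ku] := thread_le ik iu; have [_ kv] := thread_le jk jv.
by rewrite [RHS]lf -(ku _ _ fS) -(kv _ _ fS).
Qed.

Lemma dead_submod : submod (fun a => exists i, dead i a).
Proof.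
split=> [|b u v [i iu] [j jv]]; first by have [i Ji] := S0; exists i.
have [k [Jk ik jk]] := chain_bound iu.1 jv.1.
exists k; split=> // l f fS.
have [_ ku] := dead_le ik iu; have [_ kv] := dead_le jk jv.
change (b *: u l + v l = 0).
by rewrite (ku _ _ fS) (kv _ _ fS) scaler0 addr0.
Qed.

Lemma dead_thread a : (exists i, dead i a) -> exists i, thread i a.
Proof.
have [Snode _ _ _] := hS; move=> [i [Ji ia]]; exists i; split=> // j f fS.
have [_ _ hf] := Snode _ _ _ fS.
by rewrite (ia _ _ fS) (ia i id Ji) over0.
Qed.

Definition spread i (c : C) : I -> C :=
  fun j => xget 0 (fun d => exists2 f, S i j f & d = f c).

Lemma spreadE i j f c : S i j f -> spread i c j = f c.
Proof.
have [_ Suniq _ _] := hS; move=> fS; rewrite /spread.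
case: xgetP => [d _ [g gS ->]|/(_ (f c)) []]; last by exists f.
by rewrite (Suniq _ _ _ _ fS gS).
Qed.

Lemma spread_thread i c : node i -> thread i (spread i c).
Proof. by move=> Ji; split=> // j f fS; rewrite !(spreadE _ fS) (spreadE _ Ji). Qed.

Lemma colimit_exists :
  exists (Q : lmodType R) (psi : {linear Q -> M}) (inj : I -> C -> Q),
  [/\ testable Q,
      forall i, node i -> (forall a u v, inj i (a *: u + v) = a *: inj i u + inj i v) /\
        psi \o inj i =1 phi,
      forall i j f, S i j f -> inj j \o f =1 inj i,
      forall q, exists i c, node i /\ q = inj i c &
      forall i c, node i -> inj i c = 0 -> exists j f, S i j f /\ f c = 0].
Proof.
have [Snode Suniq Scomp Stot] := hS.
have hV := thread_submod; have hN := dead_submod.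
have [Q [pi [rep hQ]]] := subquot_exists hV hN dead_thread.
have [piP pi0 V_rep pi_rep] := hQ.
have QX : testable Q.
  apply: testable_subquot hQ _ => // m k l B E DBE x Vx Nx.
  have [p pP] := choice Vx; have [q qP] := choice Nx.
  have [P JP pP'] := chain_bound_fin (fun j => (pP j).1).
  have [L JL qL] := chain_bound_fin (fun j => (qP j).1).
  have [n [Jn Pn Ln]] := chain_bound JP JL.
  have leT i j h : le i j -> le j h -> le i h.
    by move=> [f fS] [g gS]; exists (g \o f); exact: Scomp gS.
  have xn j : thread n (x j) by apply: thread_le (pP j); exact: leT (pP' j) Pn.
  have Bn i : dead n (mxact B x i) by apply: dead_le (qP i); exact: leT (qL i) Ln.
  have [CX _] := phiP.
  have [//|i|y _ yP] := CX _ _ _ _ _ DBE (fun j => x j n).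
    by rewrite -mxact_fun; exact: (Bn i).2 Jn.
  exists (fun h => spread n (y h)) => j; first by exists n; exact: spread_thread.
  exists n; split=> // i f fS; have [_ _ hf] := Snode _ _ _ fS.
  change (x j i - mxact E (fun h => spread n (y h)) j i = 0); rewrite mxact_fun.
  rewrite (_ : mxact E _ j = f (mxact E y j)); last first.
    by rewrite over_mxact //; apply: eq_bigr => h _; rewrite (spreadE _ fS).
  by rewrite ((xn j).2 _ _ fS) -overB // yP over0.
have [q|a q q' e e'|e|psi psiP] := @linear_of_rel _ Q M
  (fun q e => exists i a, [/\ thread i a, pi a = q & e = phi (a i)]).
- by have [i ri] := V_rep q; exists (phi (rep q i)), i, (rep q).
- move=> [i [u [iu <- ->]]] [j [v [jv <- ->]]].
  have [k [Jk ik jk]] := chain_bound iu.1 jv.1.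
  exists k, (a *: u + v); split.
  + split=> // l f fS; have [_ _ [lf _]] := Snode _ _ _ fS.
    rewrite [RHS]lf -((thread_le ik iu).2 _ _ fS).
    by rewrite -((thread_le jk jv).2 _ _ fS).
  + by rewrite piP //; [exists i|exists j].
  have [f fS] := ik; have [g gS] := jk; rewrite [RHS]linearP.
  have [_ _ [_ pf]] := Snode _ _ _ fS; have [_ _ [_ pg]] := Snode _ _ _ gS.
  by rewrite (iu.2 _ _ fS) (jv.2 _ _ gS) -[phi (u i)]pf -[phi (v j)]pg.
- move=> [i [u [iu /pi0 u0 ->]]].
  have [|j ju] := u0; first by exists i.
  have [k [Jk ik jk]] := chain_bound iu.1 ju.1.
  have [f fS] := ik; have [_ _ [_ pf]] := Snode _ _ _ fS.
  by rewrite -[phi _]pf /= -(iu.2 _ _ fS) ((dead_le jk ju).2 _ _ Jk) linear0.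
exists Q, psi, (fun i c => pi (spread i c)); split=> //.
- move=> i Ji; have Vi c : exists j, thread j (spread i c).
    by exists i; exact: spread_thread.
  split=> [a u v|c] /=.
    rewrite -piP //; apply/(subquot_eq hV hN hQ) => //; first exact: hV.2.
    exists i; split=> // j f fS; have [_ _ [lf _]] := Snode _ _ _ fS.
    change (spread i (a *: u + v) j - (a *: spread i u j + spread i v j) = 0).
    by rewrite !(spreadE _ fS) lf subrr.
  have [j [a [ja aE ->]]] := psiP (pi (spread i c)).
  move: aE => /(subquot_eq hV hN hQ); case=> [||k ka]; [by exists j|by []|].
  have [h [Jh kh jh]] := chain_bound ka.1 ja.1.
  have [n [Jn hn [f fS]]] := chain_bound Jh Ji.
  have [g gS] : le j n.
    by have [[e eS] [e' eS']] := (jh, hn); exists (e' \o e); exact: Scomp eS'.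
  have kn : le k n.
    by have [[e eS] [e' eS']] := (kh, hn); exists (e' \o e); exact: Scomp eS'.
  have := (dead_le kn ka).2 _ _ Jn.
  change (a n - spread i c n = 0 -> phi (a j) = phi c).
  move=> /eqP; rewrite subr_eq0 (spreadE _ fS) => /eqP an.
  have [_ _ [_ pf]] := Snode _ _ _ fS; have [_ _ [_ pg]] := Snode _ _ _ gS.
  by rewrite -[phi c]pf -[phi (a j)]pg /= -(ja.2 _ _ gS) an.
- move=> i j f fS c /=; have [Ji Jj hf] := Snode _ _ _ fS.
  apply/(subquot_eq hV hN hQ).
  + by exists j; exact: spread_thread.
  + by exists i; exact: spread_thread.
  exists j; split=> // k g gS.
  change (spread j (f c) k - spread i c k = 0).
  by rewrite (spreadE _ gS) (spreadE _ (Scomp _ _ _ _ _ fS gS)) subrr.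
- move=> q; have [i ri] := V_rep q; exists i, (rep q i); split; first by case: ri.
  rewrite -[LHS]pi_rep; apply/(subquot_eq hV hN hQ) => //.
    by exists i; apply: spread_thread; case: ri.
  exists i; split=> [|j f fS]; first by case: ri.
  change (rep q j - spread i (rep q i) j = 0).
  by rewrite (spreadE _ fS) (ri.2 _ _ fS) subrr.
- move=> i c Ji /pi0 c0; have [|j jc] := c0.
    by exists i; exact: spread_thread.
  have [k [Jk [f fS] jk]] := chain_bound Ji jc.1.
  by exists k, f; split=> //; rewrite -(spreadE c fS); apply: (dead_le jk jc).2 Jk.
Qed.

Lemma cocone_exists : exists g : I -> C -> C,
  (forall i, node i -> over (g i)) /\
  forall i j f, S i j f -> g j \o f =1 g i.
Proof.
have [Q [psi [inj [QX injP injS _ _]]]] := colimit_exists.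
have [_ /(_ Q psi QX) [u uP]] := phiP.
exists (fun i => u \o inj i); split=> [i Ji|i j f fS c] /=.
  have [lin pin] := injP i Ji.
  split=> [a x y|x]; first by rewrite /= lin linearP.
  exact: etrans (uP (inj i x)) (pin x).
by rewrite -(injS _ _ _ fS).
Qed.

End Colimit.

Section Maximal.
Variables (I : Type) (o : I) (G : I -> I -> (C -> C) -> Prop).
Hypothesis G_id : forall i, G i i id.

(** The condition [G] on transition maps speaks of two nodes at a time, so that it is
    inherited by unions of chains. *)
Definition rooted_chain (S : I -> I -> (C -> C) -> Prop) :=
  [/\ chain S, node S o /\ (forall j, node S j -> exists f, S o j f) &
      forall i j f, S i j f -> G i j f].

Definition extend S (g : I -> C -> C) w (e : C -> C) i j f :=
  S i j f \/ j = w /\ (i = w /\ f = id \/ node S i /\ f = e \o g i).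

(** The new node w is put on top, mapping to it through a cocone g followed by e. *)
Lemma extend_chain S g w e :
  rooted_chain S -> (forall i, node S i -> over (g i)) ->
  (forall i j f, S i j f -> g j \o f =1 g i) -> ~ node S w ->
  over e -> (forall i, node S i -> G i w (e \o g i)) ->
  rooted_chain (extend S g w e).
Proof.
move=> [[Snode Suniq Scomp Stot] [So Soj] SG] gover gS nw eover Gw.
have nodeE i : node S i -> node (extend S g w e) i by left.
have node_w : node (extend S g w e) w by right; split=> //; left.
have node_inv i : node (extend S g w e) i -> node S i \/ i = w.
  by case=> [Si|[-> _]]; [left|right].
split; first split.
- move=> i j f [/Snode[Ji Jj hf]|[-> [[-> ->]|[Ji ->]]]].
  + by split=> //; exact: nodeE.
  + by split=> //; exact: over_id.
  by split=> //; [exact: nodeE | apply: over_comp => //; exact: gover].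
- move=> i j f f' [fS|[jw fP]] [fS'|[jw' fP']].
  + exact: Suniq fS'.
  + by case: nw; rewrite -jw'; have [] := Snode _ _ _ fS.
  + by case: nw; rewrite -jw; have [] := Snode _ _ _ fS'.
  case: fP fP' => [[iw ->]|[Ji ->]] [[iw' ->]|[Ji' ->]] //.
    by case: nw; rewrite -iw.
  by case: nw; rewrite -iw'.
- move=> i j k f f' [fS|[jw fP]] [fS'|[kw fP']].
  + by left; exact: Scomp fS'.
  + have [Ji Jj _] := Snode _ _ _ fS; case: fP' => [[jw]|[_ ->]].
      by case: nw; rewrite -jw.
    right; split=> //; right; split=> //; apply/funext => x /=.
    by congr (e _); exact: gS fS x.
  + by case: nw; rewrite -jw; have [] := Snode _ _ _ fS'.
  case: fP' => [[_ ->]|[Jj _]]; last by case: nw; rewrite -jw.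
  by right; split.
- move=> i j /node_inv[Ji|->] /node_inv[Jj|->].
  + by have [f [fS|fS]] := Stot i j Ji Jj; exists f; [left|right]; left.
  + by exists (e \o g i); left; right; split=> //; right.
  + by exists (e \o g j); right; right; split=> //; right.
  by exists id; left.
- split; first exact: nodeE.
  move=> j /node_inv[/Soj[f fS]|->]; first by exists f; left.
  by exists (e \o g o); right; split=> //; right.
by move=> i j f [/SG//|[-> [[-> ->//]|[Ji ->]]]]; exact: Gw.
Qed.

Lemma maximal_chain : exists S g,
  [/\ rooted_chain S, forall i, node S i -> over (g i),
      forall i j f, S i j f -> g j \o f =1 g i &
      forall w e, over e -> (forall i, node S i -> G i w (e \o g i)) -> node S w].
Proof.
pose un (Z : I * I * (C -> C) -> Prop) i j f := Z (i, j, f).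
have [||Z PZ Zmax] :=
  @zorn_sets _ (fun Z => rooted_chain (un Z)) (fun z => z = (o, o, id)).
- split.
  + split=> [i j f [-> -> ->]|i j f f' [_ _ ->] [_ _ ->]||] //.
    * by move=> i j k f f' [-> _ ->] [_ -> ->].
    * by move=> i j [-> _] [-> _]; exists id; left.
  + by split=> // j [-> _]; exists id.
  + by move=> i j f [-> -> ->].
- move=> F F0 FP dir.
    split.
  + split.
    * move=> i j f [Z FZ Zf]; have [[Znode _ _ _] _ _] := FP Z FZ.
      by have [Ji Jj hf] := Znode _ _ _ Zf; split=> //; exists Z.
    * move=> i j f f' [Z FZ Zf] [Z' FZ' Zf'].
      have [Z2 [FZ2 ZZ2 Z'Z2]] := dir _ _ FZ FZ'.
      have [[_ Zuniq _ _] _ _] := FP Z2 FZ2.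
      by apply: (Zuniq i j); [exact: ZZ2 | exact: Z'Z2].
    * move=> i j k f f' [Z FZ Zf] [Z' FZ' Zf'].
      have [Z2 [FZ2 ZZ2 Z'Z2]] := dir _ _ FZ FZ'.
      have [[_ _ Zcomp _] _ _] := FP Z2 FZ2.
      by exists Z2 => //; apply: (Zcomp i j k); [exact: ZZ2 | exact: Z'Z2].
    * move=> i j [Z FZ Zi] [Z' FZ' Zj].
      have [Z2 [FZ2 ZZ2 Z'Z2]] := dir _ _ FZ FZ'.
      have [[_ _ _ Ztot] _ _] := FP Z2 FZ2.
      have [f [fZ|fZ]] := Ztot i j (ZZ2 _ Zi) (Z'Z2 _ Zj); exists f.
        by left; exists Z2.
      by right; exists Z2.
  + split; first by have [Z FZ] := F0; exists Z => //; have [_ [] ] := FP Z FZ.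
    move=> j [Z FZ Zj]; have [_ [_ Zoj] _] := FP Z FZ.
    by have [f fZ] := Zoj j Zj; exists f, Z.
  + by move=> i j f [Z FZ Zf]; have [_ _ ZG] := FP Z FZ; exact: ZG.
have [hZ [Zo _] _] := PZ.
have [g [gover gS]] := cocone_exists hZ (ex_intro _ o Zo).
exists (un Z), g; split=> // w e eover Gw; apply: contrapT => nw.
have := extend_chain PZ gover gS nw eover Gw.
pose Z' (z : I * I * (C -> C)) := extend (un Z) g w e z.1.1 z.1.2 z.2.
move=> /(Zmax Z') sub; apply: nw; apply: (sub _ (w, w, id)).
  by move=> [[i j] f] Zf; left.
by right; split=> //; left.
Qed.

End Maximal.

(** Index a chain by elements of C in such a way that the copy with index x kills x,
    seen in the copy with index 0.  In a maximal chain with cocone g, an x killed by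
    some f \o g 0 could be added as a new node on top; so it is one of the nodes,
    and is killed by g 0 already. *)
Lemma stable_endo : exists2 b, over b &
  forall f x, over f -> f (b x) = 0 -> b x = 0.
Proof.
have [//|S [g [[_ [So Soj] SG] gover gS Smax]]] :=
  @maximal_chain C 0 (fun i j f => i = 0 -> f j = 0).
exists (g 0); first exact: gover.
move=> f x fover fgx; have Sx : node S x by apply: Smax fover _ => i _ ->.
have [h hS] := Soj x Sx; rewrite -(gS _ _ _ hS) /= (SG _ _ _ hS) //.
exact: over0 (gover x Sx).
Qed.

(** An element of the colimit along b is the image of some c at stage i, that is, of
    b c at the next stage; a map to C over M which kills it has to kill b c, which
    is then zero by the choice of b. *)
Lemma injective_precover : exists (Q : lmodType R) (psi : {linear Q -> M}),
  is_precover testable psi /\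
  forall u : {linear Q -> Q}, psi \o u =1 psi -> forall q, u q = 0 -> q = 0.
Proof.
have [b bover bP] := stable_endo.
pose S (i j : nat) f := exists2 n, j = (i + n)%N & f = iter n b.
have Si i : node S i by exists 0; rewrite ?addn0.
have hS : chain S.
  split=> [i j f [n _ ->]|i j f g [n -> ->] [m /addnI -> ->] //||].
  - split=> //; elim: n => [|n IH]; first exact: over_id.
    exact: over_comp IH bover.
  - move=> i j k f g [n -> ->] [m -> ->]; exists (n + m)%N; rewrite ?addnA //.
    by apply/funext => x; rewrite addnC iterD.
  move=> i j _ _; have [ij|/ltnW ji] := leqP i j.
    by exists (iter (j - i) b); left; exists (j - i)%N; rewrite ?subnKC.
  by exists (iter (i - j) b); right; exists (i - j)%N; rewrite ?subnKC.
have [Q [psi [inj [QX injP injS surj _]]]] := colimit_exists hS (ex_intro _ 0%N (Si 0%N)).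
have [CX factor] := phiP.
have [v vP] := factor Q psi QX.
exists Q, psi; split.
  split=> // X f XX; have [w wP] := factor X f XX.
  have [lin pin] := injP 0%N (Si 0%N).
  have [j jE] := linear_of lin.
  by exists (j \o w) => x; rewrite /= jE -[RHS]wP; exact: pin.
move=> u uP q uq; have [i [c [_ qE]]] := surj q.
have Sb : S i i.+1 b by exists 1%N; rewrite ?addn1.
have [lin pin] := injP i.+1 (Si _).
have injb : inj i.+1 (b c) = inj i c := injS _ _ _ Sb c.
rewrite qE -injb (bP (v \o (u \o inj i.+1))) //.
- have [j jE] := linear_of lin; by rewrite -jE linear0.
- split=> [a x y|x] /=; first by rewrite lin !linearP.
  by rewrite -[RHS]pin; apply: etrans (vP _) (uP _).
by rewrite /= injb -qE uq linear0.
Qed.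

(** If d is not in the image of e, then a maximal chain all of whose proper transition
    maps miss d uses all subsets of C as nodes, because e composed with a cocone
    misses d too.  The images of d under a cocone are then pairwise distinct, which
    embeds the power set of C in C. *)
Lemma injective_endo_surjective :
  (forall f, over f -> forall x, f x = 0 -> x = 0) ->
  forall e, over e -> forall d, exists x, e x = d.
Proof.
move=> inj e eover d; apply: contrapT => nd.
have [|S [g [[[_ _ _ Stot] _ SG] gover gS Smax]]] :=
  @maximal_chain (C -> Prop) (fun _ => False) (fun i j f => i = j \/ forall x, f x <> d).
  by left.
have allS w : node S w.
  by apply: Smax eover _ => i _; right=> x ex; apply: nd; exists (g i x).
have cmp i j f : S i j f -> g i d = g j d -> i = j.
  move=> fS; rewrite -(gS _ _ _ fS) /= => gE.
  have [//|/(_ d) []] := SG _ _ _ fS.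
  apply/eqP; rewrite -subr_eq0; apply/eqP; apply: inj (gover j (allS j)) _ _.
  by rewrite overB ?gE ?subrr //; exact: gover.
have ginj i j : g i d = g j d -> i = j.
  move=> gE; have [f [fS|fS]] := Stot i j (allS i) (allS j); first exact: cmp fS gE.
  by apply: esym; exact: cmp fS (esym gE).
pose P x := exists2 i, g i d = x & ~ i x.
have nP : ~ P (g P d) by move=> hP; have [i /ginj ->] := hP.
by apply: (nP); exists P.
Qed.

End Endomorphisms.

Lemma testable_covering : covering testable.
Proof.
move=> M; have [C0 [phi0 phi0P]] := testable_precover M.
have [C [phi [phiP inj]]] := injective_precover phi0P.
exists C, phi; split=> // f fP.
have fover : over phi f by split=> // a u v; rewrite linearP.
have surj := injective_endo_surjective phiP _ fover.
have inj' f' : over phi f' -> forall x, f' x = 0 -> x = 0.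
  move=> [lf pf]; have [u uE] := linear_of lf.
  by move=> x; rewrite -uE; apply: inj => y; rewrite /= uE; exact: pf.
have [g gK] := choice (surj inj').
exists g => // x; apply/eqP; rewrite -subr_eq0; apply/eqP; apply: (inj f fP).
by rewrite linearB gK subrr.
Qed.

End Systems.
Section FPInjective.
Variable R : pzRingType.
Implicit Types (A M X Y : lmodType R).

(** * Vanishing of Ext against finitely presented modules *)

(** A map from a projective module lifts along any d whose image contains its own
    image: factor d through its image, which is a subquotient. *)
Lemma projective_lift (P A X : lmodType R) (d : {linear A -> X}) (g : {linear P -> X}) :
  projective P -> (forall x, exists a, d a = g x) ->
  exists h : {linear P -> A}, forall x, d (h x) = g x.
Proof.
move=> PP dg; pose V y := exists a, d a = y.
have hV : submod V.
  split=> [|a _ _ [u <-] [v <-]]; first by exists 0; rewrite linear0.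
  by exists (a *: u + v); rewrite linearP.
have hN := @submod_eq0 R X.
have [_ ->|Q [pi [rep hQ]]] := subquot_exists hV hN; first exact: submod0.
have [piP pi0 _ pi_rep] := hQ.
have Vd a : V (d a) by exists a.
have [|d' d'E] := linear_of (f := fun a => pi (d a)).
  by move=> a u v; rewrite linearP piP.
have [|g' g'E] := linear_of (f := fun x => pi (g x)).
  by move=> a u v; rewrite linearP piP //; exact: dg.
have [|h hP] := PP A Q d' g'.
  move=> q; have [_ _ V_rep _] := hQ; have [a da] := V_rep q.
  by exists a; rewrite d'E da pi_rep.
exists h => x; have := hP x; rewrite /= d'E g'E => /(subquot_eq hV hN hQ) dgx.
by apply/eqP; rewrite -subr_eq0; apply/eqP/dgx => //; exact: dg.
Qed.

Definition rowmap M k (x : 'I_k -> M) (v : 'rV[R]_k) : M := \sum_j v 0 j *: x j.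

Lemma rowmap_linear M k (x : 'I_k -> M) :
  exists u : {linear 'rV[R]_k -> M}, forall v, u v = rowmap x v.
Proof.
have [|u uE] := linear_of (f := rowmap x); last by exists u.
move=> a u v; rewrite /rowmap scaler_sumr -big_split; apply: eq_bigr => j _.
by rewrite !mxE scalerDl scalerA.
Qed.

Lemma rowmap_mul M k l (C : 'M[R]_(k, l)) (y : 'I_l -> M) v :
  rowmap y (v *m C) = rowmap (mxact C y) v.
Proof. by rewrite -[RHS]/(mxact v (mxact C y) 0) mxactM. Qed.

Lemma linear_rowmap M k (u : {linear 'rV[R]_k -> M}) v :
  u v = rowmap (fun j => u 'e_j) v.
Proof.
rewrite [in LHS](row_sum_delta v) linear_sum; apply: eq_bigr => j _.
by rewrite linearZ.
Qed.

Lemma rowmap_delta M k (x : 'I_k -> M) j : rowmap x 'e_j = x j.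
Proof.
rewrite /rowmap (bigD1 j) //= mxE !eqxx scale1r big1 ?addr0 // => h hj.
by rewrite mxE (negPf hj) andbF scale0r.
Qed.

Lemma row_projective k : projective 'rV[R]_k.
Proof.
move=> A X g f gS; have [a aP] := choice (fun j => gS (f 'e_j)).
have [h hE] := rowmap_linear a; exists h => v /=.
rewrite hE (linear_rowmap f) /rowmap linear_sum; apply: eq_bigr => j _.
by rewrite linearZ /= aP.
Qed.

Lemma fg_rowmap M : finitely_generated M ->
  exists k (p : {linear 'rV[R]_k -> M}), surjection p.
Proof.
move=> [k [e eP]]; have [p pE] := rowmap_linear e; exists k, p => x.
have [c ->] := eP x; exists (\row_j c j); rewrite pE.
by apply: eq_bigr => j _; rewrite mxE.
Qed.

Lemma fg_projective_retract P : finitely_generated P -> projective P ->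
  exists k (p : {linear 'rV[R]_k -> P}) (s : {linear P -> 'rV[R]_k}),
    forall x, p (s x) = x.
Proof.
move=> fgP PP; have [k [p pS]] := fg_rowmap fgP.
by have [s sP] := PP _ _ p idfun pS; exists k, p, s.
Qed.

Definition presents m k l (B : 'M[R]_(m, k)) (C : 'M[R]_(k, l))
    (F : lmodType R) (eps : {linear 'rV[R]_l -> F}) :=
  [/\ surjection eps,
      forall v, eps v = 0 <-> exists u : 'rV_k, u *m C = v &
      forall u : 'rV_k, u *m C = 0 <-> exists z : 'rV_m, z *m B = u].

Definition FP_test n m k l (B : 'M[R]_(m, k)) (C : 'M[R]_(k, l)) :=
  exists (F : lmodType R) (eps : {linear 'rV[R]_l -> F}), FP n F /\ presents B C eps.

Lemma FP_test_mul0 n m k l (B : 'M[R]_(m, k)) (C : 'M[R]_(k, l)) :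
  FP_test n B C -> B *m C = 0.
Proof.
move=> [F [eps [_ [_ _ exB]]]]; apply/row_matrixP => i.
by rewrite row_mul row0; apply/exB; exists 'e_i; rewrite -rowE.
Qed.

(** If P is a retract of R^l with projection p and section s, then the kernel of the
    composite of p with a map e out of P is generated by s (ker e) and by the
    image of 1 - s p.  This replaces first F0 and then F1 by finite free modules,
    and keeps the next syzygy finitely generated. *)
Lemma finite_presentation (F F0 F1 F2 : lmodType R) (eps : {linear F0 -> F})
    (d0 : {linear F1 -> F0}) (d1 : {linear F2 -> F1}) :
  surjection eps -> exact_pair d0 eps -> exact_pair d1 d0 ->
  finitely_generated F0 -> projective F0 ->
  finitely_generated F1 -> projective F1 -> finitely_generated F2 ->
  exists m k l (B : 'M[R]_(m, k)) (C : 'M[R]_(k, l)) (e : {linear 'rV[R]_l -> F}),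
    presents B C e.
Proof.
move=> epsS ex0 ex1 fg0 P0 fg1 P1 fg2.
have [l [p [s ps]]] := fg_projective_retract fg0 P0.
have [k [q [t qt]]] := fg_projective_retract fg1 P1.
have [m [r rS]] := fg_rowmap fg2.
have eps0 w : eps (d0 w) = 0 by apply/ex0; exists w.
have d0d1 w : d0 (d1 w) = 0 by apply/ex1; exists w.
(* C maps R^k (+) R^l to R^l by (u1, u2) |-> s (d0 (q u1)) + (u2 - s (p u2)); its
   kernel consists of the (u1, u2) with q u1 in im d1 and u2 in im s. *)
pose SP := lin1_mx (s \o p); pose TQ := lin1_mx (t \o q).
pose D0 := lin1_mx (s \o (d0 \o q)); pose D1 := lin1_mx (t \o (d1 \o r)).
pose C := col_mx D0 (1%:M - SP).
pose B := block_mx (col_mx D1 (1%:M - TQ)) 0 0 SP.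
have CE u1 u2 : row_mx u1 u2 *m C = s (d0 (q u1)) + (u2 - s (p u2)).
  by rewrite mul_row_col mulmxBr mulmx1 !mul_rV_lin1.
have BE z1 z2 z3 : row_mx (row_mx z1 z2) z3 *m B =
    row_mx (t (d1 (r z1)) + (z2 - t (q z2))) (s (p z3)).
  rewrite mul_row_block !mulmx0 addr0 add0r mul_row_col mulmxBr mulmx1.
  by rewrite !mul_rV_lin1.
exists (m + k + l)%N, (k + l)%N, l, B, C, (eps \o p); split.
- by move=> x; have [y <-] := epsS x; exists (s y); rewrite /= ps.
- move=> v; split=> [/ex0[w dw]|[u <-]] /=.
    exists (row_mx (t w) v).
    by rewrite CE qt dw addrC subrK.
  rewrite -[u]hsubmxK CE !linearD !linearN /= !ps subrr addr0.
  exact: eps0.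
move=> u; rewrite -[u]hsubmxK; set u1 := lsubmx u; set u2 := rsubmx u; split.
  rewrite CE => u0; have d0q : d0 (q u1) = 0.
    by have := congr1 p u0; rewrite !linearD !linearN /= !ps subrr addr0 linear0.
  have [w dw] : exists w, d1 w = q u1 by apply/ex1.
  have [z rz] := rS w; exists (row_mx (row_mx z u1) u2).
  rewrite BE rz dw addrC subrK; congr row_mx.
  by move: u0; rewrite d0q linear0 add0r => /eqP; rewrite subr_eq0 => /eqP.
move=> [z]; rewrite -[z]hsubmxK -[lsubmx z]hsubmxK BE => /eq_row_mx[<- <-].
rewrite CE linearD linearB /= !qt subrr addr0 d0d1 linear0 add0r.
by rewrite ps subrr.
Qed.

Lemma FP_presentation n (F : lmodType R) :
  (if n is Some m then (1 < m)%N else true) -> FP n F ->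
  exists m k l (B : 'M[R]_(m, k)) (C : 'M[R]_(k, l)) (e : {linear 'rV[R]_l -> F}),
    presents B C e.
Proof.
move=> hn FPF.
have [m m1 [G [d [eps [Gfg epsS ex0 exS]]]]] :
    exists2 m, (1 < m)%N & finitely_n_presented m F.
  by case: n hn FPF => [m|] hn FPF; [exists m | exists 2].
have [fg0 P0] := Gfg 0%N isT; have [fg1 P1] := Gfg 1%N (ltnW m1).
have [fg2 _] := Gfg 2%N m1.
exact: finite_presentation epsS (ex0 (ltnW m1)) (exS 0%N m1) fg0 P0 fg1 P1 fg2.
Qed.

(** Comparison of the presentation with a projective resolution P of F.  The cocycle f
    is pulled back along al1 and extended to R^l; pulled back to P it is f up to
    the homotopy h. *)
Lemma presents_coboundary (F M : lmodType R) m k l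
    (B : 'M[R]_(m, k)) (C : 'M[R]_(k, l)) (e : {linear 'rV[R]_l -> F}) :
  presents B C e ->
  (forall x : 'I_k -> M, (forall i, mxact B x i = 0) ->
     exists y : 'I_l -> M, forall j, x j = mxact C y j) ->
  Ext1_zero F M.
Proof.
move=> [eS exC exB] sol P f fcoc.
have PP := @res_projective _ _ P; have augS := @res_aug_surj _ _ P.
have ex0 := @res_exact0 _ _ P; have ex1 := @res_exactS _ _ P.
pose d0 := res_d P 0; pose d1 := res_d P 1; pose aug := res_aug P.
have aug0 x : aug (d0 x) = 0 by apply/ex0; exists x.
have f0 x : d0 x = 0 -> f x = 0.
  by move=> /(ex1 0%N)[z <-]; exact: fcoc.
have [al0 al0E] := @row_projective l _ _ aug e augS.
have [|al1 al1E] := projective_lift (d := d0) (g := al0 \o mulmxr C) (@row_projective k).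
  move=> u; apply/ex0; apply: etrans (al0E _) _.
  by apply/exC; exists u.
have [be0 be0E] := PP 0%N _ _ e aug eS.
have [|be1 be1E] := projective_lift (d := mulmxr C) (g := be0 \o d0) (PP 1%N).
  move=> x; apply/exC; exact: etrans (be0E _) (aug0 x).
have [|h hE] := projective_lift (d := d0) (g := (al0 \o be0) \- idfun) (PP 0%N).
  move=> x; apply/ex0; rewrite /= linearB.
  by rewrite [res_aug P _](etrans (al0E _) (be0E x)) subrr.
have [i|y yE] := sol (fun j => f (al1 'e_j)).
  have -> : mxact B (fun j => f (al1 'e_j)) i = f (al1 (row i B)).
    rewrite -[RHS]/((f \o al1) (row i B)) linear_rowmap.
    by apply: eq_bigr => j _; rewrite mxE.
  apply: f0; rewrite al1E /= (_ : row i B *m C = 0) ?linear0 //.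
  by apply/exB; exists 'e_i; rewrite -rowE.
have [Y YE] := rowmap_linear y.
have fal1 v : f (al1 v) = Y (v *m C).
  rewrite YE rowmap_mul -[LHS]/((f \o al1) v) linear_rowmap.
  by apply: eq_bigr => j _; rewrite -yE.
exists ((Y \o be0) \- (f \o h)) => x /=.
have be1x : be1 x *m C = be0 (d0 x) := be1E x.
rewrite -/d0 -be1x -fal1; apply/eqP; rewrite -subr_eq0 -!linearB.
apply/eqP/f0; rewrite !linearB hE al1E /= be1x.
by rewrite subKr subrr.
Qed.

(** A partial projective resolution is continued by free modules on the kernels,
    after which the hypothesis on Ext^1 applies to it. *)
Lemma resolution_extends (P0 P1 F : lmodType R) (d : {linear P1 -> P0})
    (eps : {linear P0 -> F}) :
  surjection eps -> exact_pair d eps -> projective P0 -> projective P1 ->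
  forall M, Ext1_zero F M -> forall f : {linear P1 -> M},
  (forall x, d x = 0 -> f x = 0) -> exists g : {linear P0 -> M}, g \o d =1 f.
Proof.
move=> epsS ex0 pP0 pP1 M ext f fd.
pose st := {X : lmodType R & {Y : lmodType R & {linear X -> Y}}}.
pose next (s : st) : st :=
  let d := projT2 (projT2 s) in
  existT _ (freemod R {x | d x = 0}) (existT _ (projT1 s) (free_lift sval)).
pose s0 : st := existT _ P1 (existT _ P0 d).
pose obj i := projT1 (projT2 (iter i next s0)).
pose dd i : {linear obj i.+1 -> obj i} := projT2 (projT2 (iter i next s0)).
have pobj i : projective (obj i).
  by case: i => [//|[//|i]]; exact: free_projective.
have exd i : exact_pair (dd i.+1) (dd i).
  move=> y; split=> [y0|[x <-]].
    by exists (free_gen R (exist _ y y0)); rewrite /dd /= free_liftE.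
  apply: (@free_ext R _ _ (dd i \o free_lift sval) \0) => -[z z0] /=.
  by rewrite free_liftE.
pose P : projective_resolution F :=
  @ProjectiveResolution R F obj dd eps pobj epsS ex0 exd.
apply: (ext P f) => x; apply: fd; apply/(exd 0%N); by exists x.
Qed.

(** The tests for FP_n-injectivity.  To pass one is to extend to R^l a map on the
    image of C, that is, a cocycle on R^k. *)
Lemma FP_injective_testable n M :
  (if n is Some m then (1 < m)%N else true) ->
  FP_injective n M <-> testable (@FP_test n) M.
Proof.
move=> hn; split=> [MI m k l B C [F [e [FPF [eS exC exB]]]] x _ Bx|MT F FPF].
  have [f fE] := rowmap_linear x.
  have exCe : exact_pair (mulmxr C) e by move=> v; exact: exC.
  have [|g gE] := resolution_extends eS exCe (@row_projective l)
      (@row_projective k) (MI F FPF) (f := f).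
    move=> v /exB[z <-]; rewrite fE rowmap_mul /rowmap big1 // => i _.
    by rewrite Bx scaler0.
  exists (fun j => g 'e_j) => // j; have := gE 'e_j.
  rewrite /= linear_rowmap fE rowmap_mul !rowmap_delta => ->.
  by rewrite subrr.
have [m [k [l [B [C [e pres]]]]]] := FP_presentation hn FPF.
apply: (presents_coboundary pres) => x Bx.
have test : FP_test n B C by exists F, e.
have [//|y _ yE] := MT m k l B C test x _ Bx.
by exists y => j; apply/eqP; rewrite -subr_eq0; apply/eqP.
Qed.

End FPInjective.

Theorem proposition3p4 (R : pzRingType) (n : option nat)
    (hn : if n is Some m then (1 < m)%N else true) :
  covering (@FP_injective R n) /\ preenveloping (@FP_injective R n).
Proof.
have -> : @FP_injective R n = testable (@FP_test R n).
  by apply/funext => M; apply/propext/FP_injective_testable.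
have D0 := @FP_test_mul0 R n.
by split; [exact: testable_covering | exact: testable_preenveloping].
Qed.
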